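(* Let $B(t)\in\mathbb{R}^{n\times n}$ be symmetric positive semi-definite and continuous for $t\in[a,b]$. Choose $\delta\in(0,1]$ and $\varepsilon\in(0,1)$. Then, for $n_\Psi=n_\Omega=\mathcal{O}(\varepsilon^{-1}\log(\delta^{-1}))$, the Nyström++ estimator $\mathrm{Tr}_{\Psi,\Omega}(B(t))$ satisfies the inequality $$\int_a^b\big|\mathrm{Tr}(B(t))-\mathrm{Tr}_{\Psi,\Omega}(B(t))\big|\,dt\le\varepsilon\int_a^b\mathrm{Tr}(B(t))\,dt$$ with probability at least $1-\delta$.
   Context: $[a,b]$ is a bounded real interval. $\Psi\in\mathbb{R}^{n\times n_\Psi}$ and $\Omega\in\mathbb{R}^{n\times n_\Omega}$ are independent Gaussian random matrices, i.e. their entries are independent standard normal random variables; they do not depend on $t$ (the same realizations are used for all $t$). $M^\dagger$ denotes the Moore-Penrose pseudoinverse. The Nyström approximation of $B(t)$ is $\widehat{B}_\Omega(t)=(B(t)\Omega)(\Omega^\top B(t)\Omega)^\dagger(B(t)\Omega)^\top$. For $M\in\mathbb{R}^{n\times n}$ the Girard-Hutchinson estimator is $\mathrm{Tr}_\Psi(M)=\frac{1}{n_\Psi}\mathrm{Tr}(\Psi^\top M\Psi)$. The Nyström++ estimator is $$\mathrm{Tr}_{\Psi,\Omega}(B(t))=\mathrm{Tr}(\widehat{B}_\Omega(t))+\mathrm{Tr}_\Psi\big(B(t)-\widehat{B}_\Omega(t)\big).$$ The $\mathcal{O}$-condition says that a number of random vectors of this order suffices for the conclusion.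
   Formalization: The order ε⁻¹log(δ⁻¹) is replaced by ε⁻¹max(1, log(δ⁻¹)), with one universal constant: as written the bound tends to 0 as δ→1 and the claim then fails; for δ bounded away from 1 the two orders agree up to a constant. *)

(* Defs.v *)
From HB Require Import structures.
From mathcomp Require Import all_boot all_order all_algebra.
From mathcomp Require Import all_classical all_reals all_analysis.

Set Implicit Arguments.
Unset Strict Implicit.
Unset Printing Implicit Defensive.

Import Order.TTheory GRing.Theory Num.Theory.
Import numFieldNormedType.Exports.

Local Open Scope classical_set_scope.
Local Open Scope ring_scope.

Definition sym_psd (R : realType) (n : nat) (A : 'M[R]_n) : Prop :=
  A^T = A /\ forall v : 'cV[R]_n, 0 <= (v^T *m A *m v) 0 0.

(* The four Penrose equations. Note that the library's [pinvmx] is only a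
   partial inverse: in general it violates the two symmetry conditions. *)
Definition penrose (R : realType) (m n : nat)
    (A : 'M[R]_(m, n)) (X : 'M[R]_(n, m)) : Prop :=
  [/\ A *m X *m A = A, X *m A *m X = X,
      (A *m X)^T = A *m X & (X *m A)^T = X *m A].

Definition mppinv (R : realType) (m n : nat) (A : 'M[R]_(m, n)) :
  'M[R]_(n, m) := xget 0 [set X | penrose A X].

(* [mppinvP] and [mppinv_uniq] show that the default value in [mppinv] is never
   used and that the Penrose equations determine it. *)
Lemma gram_unitmx (R : realType) (r n : nat) (F : 'M[R]_(r, n)) :
  row_free F -> F *m F^T \in unitmx.
Proof.
move=> Ffree; rewrite -row_free_unit -kermx_eq0; apply/rowV0P => u /sub_kermxP.
rewrite mulmxA => /(congr1 (fun z => z *m u^T)); rewrite mul0mx => uFF0.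
have uF0 : u *m F = 0.
  apply/rowP => j; rewrite [RHS]mxE.
  move/matrixP: uFF0 => /(_ 0 0); rewrite -mulmxA -trmx_mul [LHS]mxE [RHS]mxE.
  move/eqP; rewrite psumr_eq0; last by move=> i _; rewrite [_^T _ _]mxE -expr2 sqr_ge0.
  by move=> /allP /(_ j (mem_index_enum j)); rewrite [_^T _ _]mxE mulf_eq0 orbb => /eqP.
by apply: (row_free_inj Ffree); rewrite uF0 mul0mx.
Qed.

Lemma penrose_ex (R : realType) (m n : nat) (A : 'M[R]_(m, n)) :
  exists X, penrose A X.
Proof.
have [r [C [F [AE Ffree Cfull]]]] : exists r (C : 'M[R]_(m, r)) (F : 'M[R]_(r, n)),
    [/\ A = C *m F, row_free F & row_full C].
  exists (\rank A), (col_base A), (row_base A).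
  by rewrite mulmx_base row_base_free col_base_full.
have GF : F *m F^T \in unitmx by exact: gram_unitmx.
have GC : C^T *m C \in unitmx.
  rewrite -[X in _ *m X]trmxK; apply: gram_unitmx.
  by rewrite /row_free mxrank_tr.
set Q := F^T *m invmx (F *m F^T); set L := invmx (C^T *m C) *m C^T.
have FQ : F *m Q = 1%:M by rewrite mulmxA mulmxV.
have LC : L *m C = 1%:M by rewrite -mulmxA mulVmx.
have AX : A *m (Q *m L) = C *m L by rewrite AE -mulmxA (mulmxA F) FQ mul1mx.
have XA : Q *m L *m A = Q *m F by rewrite AE -mulmxA (mulmxA L) LC mul1mx.
exists (Q *m L); split.
- by rewrite AX [in LHS]AE -mulmxA (mulmxA L) LC mul1mx -AE.
- by rewrite XA -mulmxA (mulmxA F) FQ mul1mx.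
- by rewrite AX /L mulmxA !trmx_mul trmxK trmx_inv trmx_mul trmxK mulmxA.
- by rewrite XA /Q !trmx_mul trmxK trmx_inv trmx_mul trmxK mulmxA.
Qed.

Lemma mppinvP (R : realType) (m n : nat) (A : 'M[R]_(m, n)) :
  penrose A (mppinv A).
Proof. exact: (xgetPex 0 (penrose_ex A)). Qed.

Lemma mppinv_uniq (R : realType) (m n : nat) (A : 'M[R]_(m, n)) X :
  penrose A X -> X = mppinv A.
Proof.
move: (mppinv A) (mppinvP A) => Y [AYA YAY AYs YAs] [AXA XAX AXs XAs].
have AXY : A *m X = A *m Y.
  by rewrite -[in LHS]AYA -mulmxA -AXs -AYs -trmx_mul mulmxA AXA.
have XYA : X *m A = Y *m A.
  rewrite -[in LHS]AYA !mulmxA -(mulmxA (X *m A)) -XAs -YAs -trmx_mul.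
  by rewrite mulmxA -(mulmxA Y) -mulmxA AXA.
by rewrite -XAX -mulmxA AXY mulmxA XYA YAY.
Qed.

Definition nystrom (R : realType) (n k : nat)
    (B : 'M[R]_n) (Omega : 'M[R]_(n, k)) : 'M[R]_n :=
  (B *m Omega) *m mppinv (Omega^T *m B *m Omega) *m (B *m Omega)^T.

Definition hutchinson (R : realType) (n k : nat)
    (M : 'M[R]_n) (Psi : 'M[R]_(n, k)) : R :=
  k%:R^-1 * \tr (Psi^T *m M *m Psi).

Definition nystrompp (R : realType) (n kPsi kOmega : nat) (B : 'M[R]_n)
    (Psi : 'M[R]_(n, kPsi)) (Omega : 'M[R]_(n, kOmega)) : R :=
  \tr (nystrom B Omega) + hutchinson (B - nystrom B Omega) Psi.

Definition realization (d : measure_display) (T : measurableType d)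
    (R : realType) (P : probability T R) (n k : nat)
    (X : 'M[{RV P >-> R}]_(n, k)) (w : T) : 'M[R]_(n, k) :=
  \matrix_(i, j) X i j w.

Definition mutually_independent (d : measure_display) (T : measurableType d)
    (R : realType) (P : probability T R) (I : finType)
    (X : I -> {RV P >-> R}) : Prop :=
  forall (J : {set I}) (A : I -> set R), (forall i, measurable (A i)) ->
    P [set w | forall i, i \in J -> A i (X i w)]
    = (\prod_(i in J) P (X i @^-1` A i))%E.

Definition std_normal (d : measure_display) (T : measurableType d)
    (R : realType) (P : probability T R) (X : {RV P >-> R}) : Prop :=
  forall A : set R, measurable A ->
    distribution P X A = normal_prob (0 : R) (1 : R) A.

(* The independence is joint: it covers the entries of both matrices. *)
Definition independent_gaussian (d : measure_display) (T : measurableType d)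
    (R : realType) (P : probability T R) (n kPsi kOmega : nat)
    (Psi : 'M[{RV P >-> R}]_(n, kPsi))
    (Omega : 'M[{RV P >-> R}]_(n, kOmega)) : Prop :=
  [/\ forall i j, std_normal (Psi i j),
      forall i j, std_normal (Omega i j) &
      mutually_independent
        (fun e : ('I_n * 'I_kPsi) + ('I_n * 'I_kOmega) =>
           match e with
           | inl ij => Psi ij.1 ij.2
           | inr ij => Omega ij.1 ij.2
           end)].

(* The order eps^-1 log(delta^-1). Since log(delta^-1) vanishes as delta -> 1,
   the logarithm is bounded below by 1, which changes nothing but constants for
   delta bounded away from 1. Without it a single random vector would be
   required to suffice for any eps when delta < 1 is close enough to 1, which
   is false. *)
Definition sample_order (R : realType) (eps delta : R) : R :=
  eps^-1 * Num.max 1 (ln delta^-1).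

(* Main.v *)
(**
  Adding the columns of [Omega] one at a time, the residual [B - nystrom B Omega]
  evolves by [N |-> N - N w w^T N / (w^T N w)]; in particular it is a rational,
  hence measurable, function of [B] and [Omega].  With [F] the squared Frobenius
  norm of [N] and [\tr B <= 1], one step gives [F' <= F - (w^T N^2 w / w^T N w)^2],
  so that [1 / F] grows by a constant with probability bounded below.  Hence
  [exp (- 64 / F)] is multiplied by at most [99 / 100] in expectation at each step:
  after [k] steps [F] is of order [1 / k], up to an exponentially small probability.

  Conditionally on [Omega], the Hutchinson error of the residual is a Gaussian
  quadratic form, with exponential moments controlled by [F].  Together these
  bound the exponential moment of [k / 32] times the Nystrom++ error of a matrix of
  trace at most 1 by an absolute constant.  Jensen's inequality for the weight
  [\tr (B t)] transfers this bound to the integral over [t], and Markov's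
  inequality concludes.

  The only Gaussian estimate is
  [E exp (x^T A x) <= exp (\tr A + 4 |A|^2)] for [A] symmetric with [|A|^2 <= 1 / 64]
  ([|.|] the Frobenius norm), where [A] may depend on other independent variables.
*)

Require Import Defs.
From HB Require Import structures.
From mathcomp Require Import all_boot all_order all_algebra.
From mathcomp Require Import all_classical all_reals all_analysis.
From mathcomp Require Import measurable_realfun ring lra.

Set Implicit Arguments.
Unset Strict Implicit.
Unset Printing Implicit Defensive.

Import Order.TTheory GRing.Theory Num.Theory.
Import numFieldNormedType.Exports.

Local Open Scope classical_set_scope.
Local Open Scope ring_scope.

(** * The Nystrom residual as an iterated elimination *)
Section QuadraticForms.
Variable R : realType.
Implicit Types n k : nat.

Definition bform n (A : 'M[R]_n) (u v : 'cV[R]_n) : R := (u^T *m A *m v) 0 0.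

Lemma bformE n (A : 'M[R]_n) u v :
  bform A u v = \sum_i \sum_j A i j * (u i 0 * v j 0).
Proof.
rewrite /bform mxE exchange_big; apply: eq_bigr => j _.
rewrite mxE big_distrl; apply: eq_bigr => i _ /=; rewrite mxE; ring.
Qed.

Lemma bformC n (A : 'M[R]_n) u v : A^T = A -> bform A u v = bform A v u.
Proof.
move=> sA; rewrite /bform.
have -> : v^T *m A *m u = (u^T *m A *m v)^T.
  by rewrite !trmx_mul trmxK sA mulmxA.
by rewrite [RHS]mxE.
Qed.

Lemma bformDl n (A : 'M[R]_n) u u' v :
  bform A (u + u') v = bform A u v + bform A u' v.
Proof. by rewrite /bform linearD !mulmxDl mxE. Qed.

Lemma bformDr n (A : 'M[R]_n) u v v' :
  bform A u (v + v') = bform A u v + bform A u v'.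
Proof. by rewrite /bform mulmxDr mxE. Qed.

Lemma bformZl n (A : 'M[R]_n) c u v : bform A (c *: u) v = c * bform A u v.
Proof. by rewrite /bform linearZ -!scalemxAl mxE. Qed.

Lemma bformZr n (A : 'M[R]_n) c u v : bform A u (c *: v) = c * bform A u v.
Proof. by rewrite /bform -scalemxAr mxE. Qed.

Lemma bformZ n c (A : 'M[R]_n) u v : bform (c *: A) u v = c * bform A u v.
Proof. by rewrite /bform -scalemxAr -scalemxAl mxE. Qed.

Lemma bform_delta n (A : 'M[R]_n) i j :
  bform A (delta_mx i 0) (delta_mx j 0) = A i j.
Proof. by rewrite /bform trmx_delta -rowE -colE !mxE. Qed.

Lemma bform_psd n (A : 'M[R]_n) u : sym_psd A -> 0 <= bform A u u.
Proof. by case=> _; exact. Qed.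

Lemma psd_cauchy_schwarz n (A : 'M[R]_n) u v :
  sym_psd A -> bform A u v ^+ 2 <= bform A u u * bform A v v.
Proof.
move=> pA; have sA : A^T = A by case: pA.
have key t : 0 <= bform A u u + 2 * t * bform A u v + t ^+ 2 * bform A v v.
  have := bform_psd (u + t *: v) pA.
  by rewrite bformDl !bformDr !bformZl !bformZr (bformC v u sA); lra.
have := bform_psd v pA; have := bform_psd u pA.
move: (bform A u u) (bform A v v) (bform A u v) key => a c b key a0 c0.
have [c_eq0|cN0] := eqVneq c 0.
  have [->|bN0] := eqVneq b 0; first by rewrite expr0n /= c_eq0 mulr0.
  (* With [c = 0] the quadratic is affine in [t] of slope [2 * b]; at this [t] it equals [-1]. *)
  have := key (- (a + 1) / (2 * b)); rewrite c_eq0 mulr0 addr0.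
  have -> : 2 * (- (a + 1) / (2 * b)) * b = - (a + 1) by field.
  lra.
have cp : 0 < c by rewrite lt_def cN0.
(* The minimiser of the quadratic in [t]. *)
have := key (- b / c).
have -> : a + 2 * (- b / c) * b + (- b / c) ^+ 2 * c = (a * c - b ^+ 2) / c.
  by field.
by rewrite pmulr_lge0 ?invr_gt0// subr_ge0.
Qed.

Lemma tr_dotE n (u v : 'cV[R]_n) : (u^T *m v) 0 0 = \sum_i u i 0 * v i 0.
Proof. by rewrite mxE; apply: eq_bigr => i _; rewrite mxE. Qed.

Lemma dot_eq0 n (u : 'cV[R]_n) : (u^T *m u) 0 0 = 0 -> u = 0.
Proof.
rewrite tr_dotE => /eqP; rewrite psumr_eq0; last by move=> i _; rewrite -expr2 sqr_ge0.
move=> /allP u0; apply/colP => i; rewrite [RHS]mxE.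
by have /= := u0 i (mem_index_enum i); rewrite mulf_eq0 orbb => /eqP.
Qed.

(** Cauchy-Schwarz between [A *m v] and [v]: the mixed term is the squared Euclidean norm of
    [A *m v]. *)
Lemma psd_ker n (A : 'M[R]_n) v : sym_psd A -> bform A v v = 0 -> A *m v = 0.
Proof.
move=> pA q0; have sA : A^T = A by case: pA.
have := psd_cauchy_schwarz (A *m v) v pA; rewrite q0 mulr0 => h.
have /eqP : bform A (A *m v) v ^+ 2 = 0 by apply/eqP; rewrite eq_le h sqr_ge0.
by rewrite sqrf_eq0 /bform -mulmxA => /eqP /dot_eq0.
Qed.

Lemma psd_ker_mx n k (A : 'M[R]_n) (V : 'M[R]_(n, k)) :
  sym_psd A -> V^T *m A *m V = 0 -> A *m V = 0.
Proof.
move=> pA VAV; apply/matrixP => i j.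
have : A *m col j V = 0.
  apply: psd_ker => //; rewrite /bform.
  have -> : (col j V)^T *m A *m col j V = row j (col j (V^T *m A *m V)).
    by rewrite !colE !rowE trmx_mul trmx_delta !mulmxA.
  by rewrite VAV !mxE.
by rewrite colE mulmxA -colE => /colP /(_ i); rewrite mxE => ->; rewrite !mxE.
Qed.

Lemma psd_entry n (A : 'M[R]_n) i j : sym_psd A -> A i j ^+ 2 <= A i i * A j j.
Proof.
by move=> /(psd_cauchy_schwarz (delta_mx i 0) (delta_mx j 0)); rewrite !bform_delta.
Qed.

Lemma psd_diag_ge0 n (A : 'M[R]_n) i : sym_psd A -> 0 <= A i i.
Proof. by move=> /(bform_psd (delta_mx i 0)); rewrite bform_delta. Qed.

Lemma psd_tr_ge0 n (A : 'M[R]_n) : sym_psd A -> 0 <= \tr A.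
Proof. by move=> pA; apply: sumr_ge0 => i _; exact: psd_diag_ge0. Qed.

Definition frob2 n (A : 'M[R]_n) : R := \sum_i \sum_j A i j ^+ 2.

Lemma frob2_ge0 n (A : 'M[R]_n) : 0 <= frob2 A.
Proof. by do 2 apply: sumr_ge0 => ? _; rewrite sqr_ge0. Qed.

Lemma frob2Z n c (A : 'M[R]_n) : frob2 (c *: A) = c ^+ 2 * frob2 A.
Proof.
rewrite /frob2 mulr_sumr; apply: eq_bigr => i _.
by rewrite mulr_sumr; apply: eq_bigr => l _; rewrite mxE exprMn.
Qed.

Lemma frob2_trE n (A : 'M[R]_n) : A^T = A -> frob2 A = \tr (A *m A).
Proof.
move=> sA; apply: eq_bigr => i _; rewrite mxE; apply: eq_bigr => j _.
by rewrite -[in A j i]sA mxE expr2.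
Qed.

Lemma frob2_eq0 n (A : 'M[R]_n) : frob2 A = 0 -> A = 0.
Proof.
move=> /eqP; rewrite psumr_eq0; last by move=> i _; apply: sumr_ge0 => j _; rewrite sqr_ge0.
move=> /allP h; apply/matrixP => i j; rewrite [RHS]mxE; apply/eqP.
have /= := h i (mem_index_enum i).
rewrite psumr_eq0; last by move=> l _; rewrite sqr_ge0.
by move=> /allP /(_ j (mem_index_enum j)) /=; rewrite sqrf_eq0.
Qed.

(** Sum [A i j ^+ 2 <= A i i * A j j] over all [i] and [j]. *)
Lemma frob2_le_tr n (A : 'M[R]_n) : sym_psd A -> frob2 A <= \tr A ^+ 2.
Proof.
move=> pA; rewrite expr2 /mxtrace big_distrl ler_sum// => i _ /=.
by rewrite big_distrr ler_sum//= => j _; exact: psd_entry.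
Qed.

Lemma psd_tr_eq0 n (A : 'M[R]_n) : sym_psd A -> \tr A = 0 -> A = 0.
Proof.
move=> pA t0; apply: frob2_eq0; apply/eqP; rewrite eq_le frob2_ge0 andbT.
by rewrite (le_trans (frob2_le_tr pA))// t0 expr0n.
Qed.

Lemma psd_sqr n (A : 'M[R]_n) : A^T = A -> sym_psd (A *m A).
Proof.
move=> sA; split=> [|v]; first by rewrite trmx_mul sA.
rewrite -{1}sA mulmxA -trmx_mul -mulmxA tr_dotE.
by apply: sumr_ge0 => i _; rewrite -expr2 sqr_ge0.
Qed.

Lemma psdZ n (A : 'M[R]_n) c : 0 <= c -> sym_psd A -> sym_psd (c *: A).
Proof.
move=> c0 [sA pA]; split=> [|v]; first by rewrite linearZ /= sA.
by rewrite -scalemxAr -scalemxAl mxE mulr_ge0.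
Qed.

(* One step of a Cholesky-type elimination along the direction [w]; if the
   pivot vanishes then [N *m w = 0] and the junk value [0^-1 = 0] is the right
   one. *)
Definition eliminate n (N : 'M[R]_n) (w : 'cV[R]_n) : 'M[R]_n :=
  N - (bform N w w)^-1 *: (N *m w *m (N *m w)^T).

Section Eliminate.
Variables (n : nat) (N : 'M[R]_n) (w : 'cV[R]_n).
Hypothesis pN : sym_psd N.

Let sN : N^T = N. Proof. by case: pN. Qed.

Lemma eliminate_sym : (eliminate N w)^T = eliminate N w.
Proof. by rewrite /eliminate linearB linearZ /= trmx_mul trmxK sN. Qed.

Let Nw_dot u : (N *m w)^T *m u = (bform N w u)%:M.
Proof. by rewrite trmx_mul sN [LHS]mx11_scalar. Qed.

Lemma bform_eliminate u v :
  bform (eliminate N w) u v = bform N u v - (bform N w w)^-1 * (bform N w u * bform N w v).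
Proof.
have -> : bform (eliminate N w) u v = bform N u v -
    (bform N w w)^-1 * (u^T *m (N *m w *m (N *m w)^T) *m v) 0 0.
  rewrite {1}/bform /eliminate mulmxBr mulmxBl -scalemxAr -scalemxAl.
  by rewrite [LHS]mxE [X in _ + X]mxE [X in - X]mxE.
congr (_ - _ * _); rewrite mulmxA -mulmxA Nw_dot mulmxA.
by rewrite mul_mx_scalar [LHS]mxE mulrC -/(bform N u w) (bformC _ _ sN).
Qed.

(** By [bform_eliminate], nonnegativity of the new form at [v] is Cauchy-Schwarz for [N] between [w]
    and [v]. *)
Lemma eliminate_psd : sym_psd (eliminate N w).
Proof.
split=> [|v]; first exact: eliminate_sym.
rewrite -/(bform _ _ _) bform_eliminate -expr2 subr_ge0 mulrC.
have [->|q0] := eqVneq (bform N w w) 0; first by rewrite invr0 mulr0 bform_psd.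
rewrite ler_pdivrMr ?lt_def ?q0 ?bform_psd// mulrC.
exact: psd_cauchy_schwarz.
Qed.

Lemma eliminate_self : eliminate N w *m w = 0.
Proof.
rewrite /eliminate mulmxBl -scalemxAl -(mulmxA (N *m w)) Nw_dot mul_mx_scalar scalerA.
have [q0|q0] := eqVneq (bform N w w) 0; last by rewrite mulVf// scale1r subrr.
by rewrite psd_ker// scaler0 subrr.
Qed.

Lemma eliminate_ker (v : 'cV[R]_n) : N *m v = 0 -> eliminate N w *m v = 0.
Proof.
move=> Nv; rewrite /eliminate mulmxBl -scalemxAl -(mulmxA (N *m w)) Nw_dot Nv.
have -> : bform N w v = 0 by rewrite /bform -mulmxA Nv mulmx0 mxE.
by rewrite mul_mx_scalar scale0r scaler0 subrr.
Qed.

Lemma bform_sqr u v : bform (N *m N) u v = bform N (N *m u) v.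
Proof. by rewrite /bform trmx_mul sN mulmxA. Qed.

Lemma tr_outer (u v : 'cV[R]_n) : \tr (u *m v^T) = (u^T *m v) 0 0.
Proof.
by rewrite tr_dotE; apply: eq_bigr => i _; rewrite mxE big_ord1 mxE.
Qed.

Lemma tr_eliminate :
  \tr (eliminate N w) = \tr N - (bform N w w)^-1 * bform (N *m N) w w.
Proof.
rewrite /eliminate linearB linearZ /= tr_outer trmx_mul sN.
by rewrite /bform !mulmxA.
Qed.

Lemma tr_eliminate_le : \tr (eliminate N w) <= \tr N.
Proof.
rewrite tr_eliminate gerBl mulr_ge0 ?invr_ge0 ?bform_psd//.
exact: psd_sqr.
Qed.

(** Expanding the trace of the square gives exactly [F - 2 * q3 / q1 + (q2 / q1) ^+ 2], and
    Cauchy-Schwarz between [N *m w] and [w] gives [q2 ^+ 2 <= q1 * q3]. *)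
Lemma frob2_eliminate :
  frob2 (eliminate N w) <= frob2 N - (bform (N *m N) w w / bform N w w) ^+ 2.
Proof.
set q1 := bform N w w; set q2 := bform (N *m N) w w.
pose q3 := bform N (N *m w) (N *m w).
have E : frob2 (eliminate N w) = frob2 N - 2 * q1^-1 * q3 + q1^-1 ^+ 2 * q2 ^+ 2.
  rewrite !frob2_trE ?eliminate_sym// /eliminate -/q1.
  set Y := N *m w *m (N *m w)^T.
  have trNY : \tr (N *m Y) = q3 by rewrite mulmxA tr_outer trmx_mul sN.
  have q2E : (N *m w)^T *m (N *m w) = q2%:M.
    by rewrite Nw_dot /q2 bform_sqr (bformC _ _ sN).
  have trYY : \tr (Y *m Y) = q2 ^+ 2.
    rewrite {2}/Y mulmxA -(mulmxA _ _ (N *m w)) q2E mul_mx_scalar -scalemxAl mxtraceZ.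
    by rewrite tr_outer q2E mxE mulr1n expr2.
  have -> : (N - q1^-1 *: Y) *m (N - q1^-1 *: Y) =
      N *m N - q1^-1 *: (N *m Y) - q1^-1 *: (Y *m N) + q1^-1 ^+ 2 *: (Y *m Y).
    rewrite mulmxBr !mulmxBl -!scalemxAr -!scalemxAl scalerA opprB expr2.
    by rewrite [in RHS](addrAC (N *m N)) -[RHS]addrA (addrC (- (q1^-1 *: (N *m Y)))).
  rewrite mxtraceD 2!(raddfB (@mxtrace R n)) /= !mxtraceZ (mxtrace_mulC Y N) trNY trYY.
  ring.
have CS : q2 ^+ 2 <= q1 * q3.
  by rewrite /q2 bform_sqr (bformC _ _ sN); exact: psd_cauchy_schwarz.
rewrite E expr_div_n -addrA lerD2l.
have [->|q10] := eqVneq q1 0; first by rewrite invr0 !expr0n /= invr0 !(mulr0, mul0r) oppr0 addr0.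
have q1p : 0 < q1 by rewrite lt_def q10 bform_psd.
have -> : q2 ^+ 2 / q1 ^+ 2 = q1^-1 * (q2 ^+ 2 / q1) by field.
have -> : q1^-1 ^+ 2 * q2 ^+ 2 = q1^-1 * (q2 ^+ 2 / q1) by field.
have : q2 ^+ 2 / q1 <= q3 by rewrite ler_pdivrMr// mulrC.
have : 0 < q1^-1 by rewrite invr_gt0.
by move: (q2 ^+ 2 / q1) (q1^-1) => a c c0 ha; nra.
Qed.

End Eliminate.

(** This homogeneity, which includes [c = 0], later reduces the estimates to matrices of trace at
    most 1. *)
Lemma eliminateZ n (c : R) (N : 'M[R]_n) w :
  eliminate (c *: N) w = c *: eliminate N w.
Proof.
have bZ := bformZ c N w w.
have yZ : c *: N *m w = c *: (N *m w) by rewrite -scalemxAl.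
have -> : eliminate (c *: N) w = c *: N -
    ((c * bform N w w)^-1 * c * c) *: (N *m w *m (N *m w)^T).
  rewrite /eliminate bZ yZ (_ : (c *: (N *m w))^T = c *: (N *m w)^T); last exact: linearZ.
  by rewrite -(scalemxAr c (c *: (N *m w))) -(scalemxAl c (N *m w)) !scalerA.
rewrite /eliminate scalerBr scalerA.
have [->|c0] := eqVneq c 0; first by rewrite !mul0r invr0 !mul0r.
by congr (_ - _ *: _); rewrite invfM (mulrC c^-1) mulfVK// mulrC.
Qed.

Definition residual n k (B : 'M[R]_n) (Om : 'M[R]_(n, k)) (s : seq 'I_k) : 'M[R]_n :=
  foldl (fun N j => eliminate N (col j Om)) B s.

Lemma residual_rcons n k (B : 'M[R]_n) (Om : 'M[R]_(n, k)) s j :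
  residual B Om (rcons s j) = eliminate (residual B Om s) (col j Om).
Proof. by rewrite /residual foldl_rcons. Qed.

Lemma residualZ n k (c : R) (B : 'M[R]_n) (Om : 'M[R]_(n, k)) s :
  residual (c *: B) Om s = c *: residual B Om s.
Proof.
by elim/last_ind: s => [|s j IH] //; rewrite !residual_rcons IH eliminateZ.
Qed.

Lemma residual_psd n k (B : 'M[R]_n) (Om : 'M[R]_(n, k)) s :
  sym_psd B -> sym_psd (residual B Om s).
Proof.
move=> pB; elim/last_ind: s => [|s j IH] //.
by rewrite residual_rcons; exact: eliminate_psd.
Qed.

Lemma tr_residual n k (B : 'M[R]_n) (Om : 'M[R]_(n, k)) s :
  sym_psd B -> \tr (residual B Om s) <= \tr B.
Proof.
move=> pB; elim/last_ind: s => [|s j IH] //.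
rewrite residual_rcons (le_trans _ IH)// tr_eliminate_le//.
exact: residual_psd.
Qed.

Lemma residual_ker n k (B : 'M[R]_n) (Om : 'M[R]_(n, k)) s j :
  sym_psd B -> j \in s -> residual B Om s *m col j Om = 0.
Proof.
move=> pB; elim/last_ind: s => [|s i IH] //.
rewrite residual_rcons mem_rcons inE => /orP[/eqP->|/IH js].
  exact/eliminate_self/residual_psd.
by apply: eliminate_ker => //; exact: residual_psd.
Qed.

Lemma residual_range n k (B : 'M[R]_n) (Om : 'M[R]_(n, k)) s :
  exists Z, residual B Om s = B - B *m Om *m Z.
Proof.
elim/last_ind: s => [|s j [Z IH]]; first by exists 0; rewrite mulmx0 subr0.
rewrite residual_rcons /eliminate; set c := (bform _ _ _)^-1.
set y := (residual _ _ _ *m _)^T.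
(* The vector subtracted at this step is [N *m col j Om = B *m Om *m (delta_mx j 0 - Z *m col j
   Om)], so it stays in the range of [B *m Om]. *)
exists (Z + c *: ((delta_mx j 0 - Z *m col j Om) *m y)).
rewrite {1 2}IH colE mulmxDr opprD addrA -scalemxAr; congr (_ - _ *: _).
by rewrite !(mulmxBl, mulmxBr) !mulmxA.
Qed.

(* Both sides are symmetric, of the form [B - B *m Om *m Z] and kill [Om];
   these properties determine the matrix. *)
Lemma nystrom_residual n k (B : 'M[R]_n) (Om : 'M[R]_(n, k)) :
  sym_psd B -> B - nystrom B Om = residual B Om (enum 'I_k).
Proof.
move=> pB; have sB : B^T = B by case: pB.
set K := Om^T *m B *m Om; set X := mppinv K.
have sK : K^T = K by rewrite /K !trmx_mul trmxK sB mulmxA.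
have [KXK XKX KXs XKs] := mppinvP K; rewrite -/X in KXK XKX KXs XKs.
(* The transpose of [X] satisfies the Penrose equations of the symmetric matrix [K], so uniqueness
   applies. *)
have Xs : X^T = X.
  apply: mppinv_uniq; split.
  - by have := congr1 trmx KXK; rewrite (trmx_mul (K *m X)) (trmx_mul K) sK mulmxA.
  - by have := congr1 trmx XKX; rewrite (trmx_mul (X *m K)) (trmx_mul X) sK mulmxA.
  - by rewrite (trmx_mul K) trmxK sK -[LHS]XKs (trmx_mul X) sK.
  - by rewrite (trmx_mul X^T) trmxK sK -[LHS]KXs (trmx_mul K) sK.
(* The orthogonal projector onto the kernel of [K]. It makes the Nystrom approximation exact on the
   range of [Om] even when [K] is singular. *)
pose Z := 1%:M - K *m X.
have ZK : Z *m K = 0 by rewrite /Z mulmxBl mul1mx KXK subrr.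
have Zs : Z^T = Z by rewrite /Z linearB /= trmx1 KXs.
have BOmZ : B *m (Om *m Z) = 0.
  apply: psd_ker_mx => //; rewrite trmx_mul Zs.
  by rewrite -!mulmxA (mulmxA Om^T) (mulmxA _ Om) -/K mulmxA ZK mul0mx.
have MOm : (B - nystrom B Om) *m Om = 0.
  have XKE : X *m K = K *m X by rewrite -XKs (trmx_mul X) sK Xs.
  have -> : (B - nystrom B Om) *m Om = B *m (Om *m (1%:M - X *m K)).
    rewrite mulmxBl /nystrom -/K -/X (trmx_mul B) sB !mulmxBr mulmx1 /K.
    by rewrite !mulmxA.
  by rewrite XKE.
set N := residual B Om _.
have NOm : N *m Om = 0.
  apply/matrixP => i j; have /colP/(_ i) := residual_ker Om pB (mem_enum 'I_k j).
  by rewrite colE mulmxA -colE !mxE.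
have [Y NE] := residual_range B Om (enum 'I_k); rewrite -/N in NE.
have Ns : N^T = N by case: (residual_psd Om (enum 'I_k) pB).
have Ms : (B - nystrom B Om)^T = B - nystrom B Om.
  by rewrite linearB /= /nystrom !trmx_mul !trmxK sB -/K -/X Xs !mulmxA.
set M := B - _ in MOm Ms *.
pose D := Y - X *m (B *m Om)^T.
have MN : M - N = B *m (Om *m D).
  rewrite /M NE /nystrom -/K -/X opprB addrC addrA subrK /D.
  by rewrite mulmxA mulmxBr !mulmxA.
(* With [V = Om *m D], [M - N = B *m V]. Moreover [V^T *m B *m V = D^T *m Om^T *m (M - N)] vanishes,
   since [M - N] is symmetric and kills [Om]. *)
apply/eqP; rewrite -subr_eq0; apply/eqP; rewrite MN; apply: psd_ker_mx => //.
rewrite trmx_mul -mulmxA -MN -!mulmxA.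
have MNs : (M - N)^T = M - N.
  by transitivity (M^T - N^T); [exact: linearB|rewrite Ms Ns].
have -> : Om^T *m (M - N) = ((M - N) *m Om)^T by rewrite trmx_mul MNs.
by rewrite mulmxBl MOm NOm subrr trmx0 mulmx0.
Qed.

End QuadraticForms.

(** * Independent standard normal variables *)
(** The Radon-Nikodym derivative with respect to Lebesgue measure agrees almost everywhere with
    [normal_pdf], as both have the same integrals over measurable sets. *)
Lemma integral_normal_prob (R : realType) (m s : R) (f : R -> \bar R) :
  measurable_fun setT f -> (forall x, 0 <= f x)%E ->
  (\int[normal_prob m s]_x f x =
   \int[lebesgue_measure]_x (f x * (normal_pdf m s x)%:E))%E.
Proof.
move=> mf f0.
have dom := normal_prob_dominates m s.
rewrite -(Radon_Nikodym_SigmaFinite.change_of_variables dom)//.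
have irn := Radon_Nikodym_SigmaFinite.f_integrable dom.
apply: ae_eq_integral => //.
- by apply: emeasurable_funM => //; exact: measurable_int irn.
- apply: emeasurable_funM => //; apply/measurable_EFinP.
  exact: measurable_normal_pdf.
- apply: ae_eqe_mul2l; apply: integral_ae_eq => //.
  + by apply/measurable_EFinP; exact: measurable_normal_pdf.
  + by move=> E _ mE; rewrite -Radon_Nikodym_SigmaFinite.f_integral.
Qed.

Lemma integral_normal_expR_quad (R : realType) (a b : R) : a < 1 / 2 ->
  (\int[normal_prob 0 1]_x (expR (a * x ^+ 2 + b * x))%:E =
   (expR (b ^+ 2 / (2 * (1 - 2 * a))) / Num.sqrt (1 - 2 * a))%:E)%E.
Proof.
move=> a12; have d0 : 0 < 1 - 2 * a by lra.
set d := 1 - 2 * a in d0 *.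
have sd0 : 0 < Num.sqrt d by rewrite sqrtr_gt0.
rewrite integral_normal_prob; last by move=> x; rewrite lee_fin expR_ge0.
  (* Completing the square turns the integrand into [c] times the normal density of mean [b / d] and
     variance [1 / d]. *)
  pose s := (Num.sqrt d)^-1; pose m := b / d.
  have s0 : s != 0 by rewrite invr_neq0// gt_eqF.
  have sE : s ^+ 2 = d^-1 by rewrite /s exprVn sqr_sqrtr// ltW.
  pose c := expR (b ^+ 2 / (2 * d)) / Num.sqrt d.
  under eq_integral => x _.
    have -> : ((expR (a * x ^+ 2 + b * x))%:E * (normal_pdf 0 1 x)%:E =
        c%:E * (normal_pdf m s x)%:E)%E.
      rewrite -!EFinM; congr EFin; rewrite !normal_pdfE ?oner_eq0//.
      rewrite /normal_peak /normal_fun sE expr1n mul1r subr0.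
      have -> : (Num.sqrt (d^-1 * pi *+ 2))^-1 = Num.sqrt d * (Num.sqrt (pi *+ 2))^-1.
        rewrite -mulrnAr sqrtrM ?invr_ge0 ?(ltW d0)// invfM.
        by rewrite sqrtrV ?(ltW d0)// invrK.
      have EE : expR (a * x ^+ 2 + b * x) * expR (- x ^+ 2 / 2) =
          expR (b ^+ 2 / (2 * d)) * expR (- (x - m) ^+ 2 / (d^-1 *+ 2)).
        rewrite -!expRD; congr expR; rewrite /m -mulr_natr.
        by move: d0; rewrite /d => d0; field; rewrite gt_eqF.
      rewrite mulrCA EE /c; field.
      by apply/andP; split; rewrite gt_eqF// sqrtr_gt0 mulrn_wgt0// pi_gt0.
    over.
  rewrite ge0_integralZl//; last 3 first.
  - by apply/measurable_EFinP; exact: measurable_normal_pdf.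
  - by move=> x _; rewrite lee_fin normal_pdf_ge0.
  - by rewrite lee_fin divr_ge0 ?expR_ge0// sqrtr_ge0.
  by rewrite integral_normal_pdf mule1.
apply/measurable_EFinP; apply: measurableT_comp => //.
apply: measurable_funD; apply: measurable_funM => //.
Qed.

(* Real families indexed by [I], with the product sigma-algebra; the alias keeps
   it apart from the other structures on the function type. *)
Definition coords (R : realType) (I : finType) : Type := I -> R.

HB.instance Definition _ (R : realType) (I : finType) :=
  Pointed.copy (coords R I) (I -> R).

Definition rectangles (R : realType) (I : finType) : set (set (coords R I)) :=
  [set [set x : coords R I | forall i, A i (x i)] |
    A in [set A : I -> set R | forall i, measurable (A i)]].

HB.instance Definition _ (R : realType) (I : finType) :=
  Measurable.copy (coords R I) (g_sigma_algebraType (@rectangles R I)).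

Definition iid_normal (R : realType) (I : finType)
    (mu : probability (coords R I) R) : Prop :=
  forall A : I -> set R, (forall i, measurable (A i)) ->
    mu [set x : coords R I | forall i, A i (x i)] = (\prod_i normal_prob 0 1 (A i))%E.

Definition upd (R : realType) (I : finType) (x : coords R I) (i : I) (g : R) :
    coords R I :=
  fun j => if j == i then g else x j.

(** * Product law on coordinate families and resampling of one coordinate *)

Section Coordinates.
Variables (R : realType) (I : finType).
Local Notation E := (coords R I).

Lemma measurable_coord (i : I) : measurable_fun setT (fun x : E => x i).
Proof.
move=> _ Y mY; rewrite setTI; apply: sub_sigma_algebra.
exists (fun j => if j == i then Y else setT); first by move=> j /=; case: ifP.
apply/seteqP; split=> x /= h; first by have := h i; rewrite eqxx.
by move=> j; case: eqP => // ->.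
Qed.

Lemma measurable_to_coords d (T : measurableType d) (X : T -> E) :
  (forall i, measurable_fun setT (fun w => X w i)) -> measurable_fun setT X.
Proof.
move=> mX; apply: (@measurability _ _ T E setT X (@rectangles R I)) => //.
move=> _ [_ [A mA <-] <-]; rewrite setTI.
have -> : X @^-1` [set x : E | forall i, A i (x i)] =
    \big[setI/setT]_(i : I) ((fun w => X w i) @^-1` A i).
  apply/seteqP; split=> w /= h.
    by rewrite -bigcap_seq => i _; exact: h.
  by move=> i; move: h; rewrite -bigcap_seq; apply; rewrite /= mem_index_enum.
apply: bigsetI_measurable => i _.
by have := mX i measurableT (A i) (mA i); rewrite setTI.
Qed.

Lemma measurable_upd (i : I) :
  measurable_fun setT (fun p : measurableTypeR R * E => upd p.2 i p.1 : E).
Proof.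
apply: measurable_to_coords => j; rewrite /upd; case: eqP => _.
  exact: measurable_fst.
exact: (measurableT_comp (measurable_coord j) measurable_snd).
Qed.

(** Rectangles are stable under intersection and generate the sigma-algebra. *)
Lemma iid_normal_unique (mu nu : probability E R) :
  iid_normal mu -> iid_normal nu -> forall A, measurable A -> mu A = nu A.
Proof.
move=> Hmu Hnu A mA.
apply: (@measure_unique _ R E (@rectangles R I) (fun=> setT)) => //.
- move=> _ _ [A1 mA1 <-] [A2 mA2 <-]; exists (fun i => A1 i `&` A2 i).
    by move=> i; apply: measurableI; [exact: mA1|exact: mA2].
  by apply/seteqP; split=> x /= h; [split=> i; have [] := h i|move=> i; case: h].
- by move=> _; exists (fun=> setT) => //; apply/seteqP; split.
- by apply/seteqP; split=> // x _; exists 0%N.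
- by move=> _ [B mB <-]; rewrite /= Hmu// Hnu.
- by move=> _ /=; rewrite probability_setT ltry.
Qed.

Variable mu : probability E R.
Hypothesis mu_iid : iid_normal mu.
Local Notation gauss := (normal_prob (0 : R) 1).

Local Open Scope ereal_scope.

Let upd_mfun (i : I) : {mfun (measurableTypeR R * E)%type >-> E} :=
  HB.pack (fun p : measurableTypeR R * E => upd p.2 i p.1 : E)
    (isMeasurableFun.Build _ _ _ _ _ (measurable_upd i)).

(** Overwriting coordinate [i] by a fresh independent normal preserves the law: on a rectangle the
    old constraint on [i] is dropped and the fresh variable supplies its factor. *)
Lemma iid_normal_resample (i : I) :
  iid_normal (distribution (gauss \x mu) (upd_mfun i)).
Proof.
move=> A mA; rewrite /distribution /pushforward /=.
pose A' j := if j == i then setT else A j.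
have mA' j : measurable (A' j) by rewrite /A'; case: ifP.
have -> : (fun p : measurableTypeR R * E => upd p.2 i p.1 : E) @^-1`
    [set x : E | forall j, A j (x j)] =
    A i `*` [set x : E | forall j, A' j (x j)].
  apply/seteqP; split=> [[g x]|[g x] [/= Ag Ax]] /=; rewrite /upd.
    move=> h; split=> [|j]; first by have := h i; rewrite eqxx.
    by rewrite /A'; have := h j; case: eqP.
  by move=> j; have := Ax j; rewrite /A'; case: eqP => // ->.
rewrite product_measure1E; first last.
- by apply: sub_sigma_algebra; exists A'.
- exact: mA.
rewrite /= (mu_iid mA') (bigD1 i)//= [in RHS](bigD1 i)//=; congr (_ * _).
rewrite /A' eqxx probability_setT mul1e.
by apply: eq_bigr => j /negbTE ->.
Qed.

Variables (i : I) (f : E -> \bar R).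
Hypotheses (mf : measurable_fun setT f) (f0 : forall x, 0 <= f x).

Let mfupd : measurable_fun setT (fun p : measurableTypeR R * E => f (upd p.2 i p.1)).
Proof. exact: (measurableT_comp mf (measurable_upd i)). Qed.

Lemma measurable_resample :
  measurable_fun setT (fun x : E => \int[gauss]_g f (upd x i g)).
Proof. exact: (measurable_fun_fubini_tonelli_G _ mfupd). Qed.

(** Fubini for a single coordinate, obtained from invariance of the law under resampling, with no
    splitting of the index set. *)
Lemma resample :
  \int[mu]_x f x = \int[mu]_x \int[gauss]_g f (upd x i g).
Proof.
transitivity (\int[distribution (gauss \x mu) (upd_mfun i)]_x f x).
  apply: eq_measure_integral => A mA _.
  exact: (iid_normal_unique mu_iid (iid_normal_resample i) mA).
rewrite ge0_integral_distribution//.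
by rewrite (fubini_tonelli2 (fun p : measurableTypeR R * E => f (upd p.2 i p.1))).
Qed.

Lemma resample_le (h : E -> \bar R) :
  measurable_fun setT h ->
  (forall x, \int[gauss]_g f (upd x i g) <= h x) ->
  \int[mu]_x f x <= \int[mu]_x h x.
Proof.
move=> mh fh; rewrite resample; apply: ge0_le_integral => //.
- by move=> x _; exact: integral_ge0.
- exact: measurable_resample.
Qed.

End Coordinates.

(* Integrating one Gaussian coordinate out of [exp (x^T A x)], where [a] is its
   diagonal entry and [b] the rest of its row, leaves [exp] of the quadratic form
   [A + g b b^T].  The squared Frobenius norm does not grow, because the removed
   row and column contribute [a ^+ 2 + 2 * |b|^2]. *)
Section SchurStep.
Variables (R : realType) (I : eqType) (s : seq I).
Variables (A : I -> I -> R) (b : I -> R) (a g nA nb : R).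
Hypothesis gE : g = 2 / (1 - 2 * a).
Hypothesis nAE : nA = \sum_(i <- s) \sum_(j <- s) A i j ^+ 2.
Hypothesis nbE : nb = \sum_(i <- s) b i ^+ 2.
Local Notation cross := (\sum_(i <- s) \sum_(j <- s) A i j * (b i * b j)).

Hypothesis small : a ^+ 2 + 2 * nb + nA <= 1 / 64.

Let a20 : 0 <= a ^+ 2.
Proof. exact: sqr_ge0. Qed.

Let nA0 : 0 <= nA.
Proof. by rewrite nAE; do 2 apply: sumr_ge0 => ? _; rewrite sqr_ge0. Qed.

Let nb0 : 0 <= nb.
Proof. by rewrite nbE; apply: sumr_ge0 => ? _; rewrite sqr_ge0. Qed.

Let facts : [/\ a ^+ 2 + 2 * nb + nA <= 1 / 64, 0 <= a ^+ 2, 0 <= nA & 0 <= nb].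
Proof. by []. Qed.

Lemma sum_prod_sqr : \sum_(i <- s) \sum_(j <- s) (b i * b j) ^+ 2 = nb ^+ 2.
Proof.
rewrite nbE expr2 big_distrl; apply: eq_bigr => i _ /=.
by rewrite big_distrr; apply: eq_bigr => j _ /=; rewrite exprMn.
Qed.

Let sum_sqrD (c e : R) :
  \sum_(i <- s) \sum_(j <- s) (c * A i j + e * (b i * b j)) ^+ 2 =
  c ^+ 2 * nA + 2 * c * e * cross + e ^+ 2 * nb ^+ 2.
Proof.
rewrite -sum_prod_sqr nAE !big_distrr -!big_split; apply: eq_bigr => i _ /=.
rewrite !big_distrr -!big_split; apply: eq_bigr => j _ /=; ring.
Qed.

(** Cauchy-Schwarz for the Frobenius inner product of [A] and [b b^T], where [A] has norm at most
    1/8. It is read off from the nonnegative square of [nb A - (1/8) b b^T]. *)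
Let cross_le : cross <= 1 / 8 * nb.
Proof.
have [nb_eq0|nb_neq0] := eqVneq nb 0.
  rewrite nb_eq0 mulr0 big1_seq// => i /= si.
  have bi : b i = 0.
    move: nb_eq0; rewrite nbE => /eqP; rewrite psumr_eq0; last by move=> l _; rewrite sqr_ge0.
    by move=> /allP/(_ i si) /=; rewrite sqrf_eq0 => /eqP.
  by rewrite big1// => j _; rewrite bi mul0r mulr0.
have [? ? ? ?] := facts; have nbp : 0 < nb by rewrite lt_def nb_neq0.
have : 0 <= \sum_(i <- s) \sum_(j <- s) (nb * A i j + - (1 / 8) * (b i * b j)) ^+ 2.
  by do 2 apply: sumr_ge0 => ? _; rewrite sqr_ge0.
rewrite sum_sqrD; move: cross => cr h.
have nA64 : nA <= 1 / 64 by lra.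
have : 0 <= nb * (nb * (1 / 64 + 1 / 64) - 2 / 8 * cr).
  apply: le_trans h _; have nb2 : 0 <= nb ^+ 2 by exact: sqr_ge0.
  nra.
by rewrite pmulr_rge0//; lra.
Qed.

Let a_bound : - (1 / 8) <= a <= 1 / 8.
Proof.
have [? ? ? ?] := facts; have : a ^+ 2 <= 1 / 64 by lra.
by move=> h; apply/andP; split; nra.
Qed.

Let d0 : 3 / 4 <= 1 - 2 * a.
Proof. by move/andP: a_bound => [? ?]; lra. Qed.

Let g_bound : 0 < g <= 8 / 3.
Proof.
have ? := d0; have dp : 0 < 1 - 2 * a by lra.
by rewrite gE divr_gt0//= ler_pdivrMr//; lra.
Qed.

(** Since [g <= 8/3] and [nb <= 1/128], the cross term costs at most [2/3 * nb] and the square of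
    [g b b^T] at most [1/18 * nb]. *)
Lemma schur_sqr_le :
  \sum_(i <- s) \sum_(j <- s) (A i j + g * (b i * b j)) ^+ 2 <= nA + nb.
Proof.
under eq_bigr do under eq_bigr do rewrite -[A _ _]mul1r.
have [? ? ? ?] := facts; rewrite sum_sqrD expr1n mul1r mulr1.
move: cross cross_le => cr cr_le; move/andP: g_bound => [g0 g1].
have nb128 : nb <= 1 / 128 by lra.
have h1 : g * cr <= g * (1 / 8 * nb) by rewrite ler_pM2l.
have h2 : g * (1 / 8 * nb) <= 1 / 3 * nb by nra.
have h3 : g ^+ 2 <= 64 / 9 by nra.
have h4 : g ^+ 2 * nb ^+ 2 <= 64 / 9 * (1 / 128 * nb).
  have g20 : 0 <= g ^+ 2 by exact: sqr_ge0.
  have nb2 : nb ^+ 2 <= 1 / 128 * nb by nra.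
  have nb20 : 0 <= nb ^+ 2 by exact: sqr_ge0.
  nra.
lra.
Qed.

(** The removed row and column release [8 * nb]. This pays for the trace increase, at most
    [8/3 * nb], and for [4 * nb] from [schur_sqr_le]. *)
Lemma schur_trace_le :
  \sum_(i <- s) (A i i + g * (b i * b i)) +
    4 * \sum_(i <- s) \sum_(j <- s) (A i j + g * (b i * b j)) ^+ 2 <=
  \sum_(i <- s) A i i + 4 * (2 * nb + nA).
Proof.
have [? ? ? ?] := facts; have := schur_sqr_le.
rewrite big_split /= -big_distrr /=.
under [in X in _ -> _ + g * X + _ <= _]eq_bigr do rewrite -expr2.
rewrite -nbE; move: (\sum_(i <- s) \sum_(j <- s) _) => S hS.
move/andP: g_bound => [g0 g1].
have : g * nb <= 8 / 3 * nb by rewrite ler_wpM2r.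
lra.
Qed.

(** After squaring and using [1 + y <= expR y], it remains that [(1 + 2a + 8a^2)(1 - 2a) = 1 + 4a^2
    - 16a^3] is at least 1, true for [a <= 1/8]. *)
Lemma inv_sqrt_le_expR : (Num.sqrt (1 - 2 * a))^-1 <= expR (a + 4 * a ^+ 2).
Proof.
have ? := d0; have dp : 0 < 1 - 2 * a by lra.
have sp : 0 < Num.sqrt (1 - 2 * a) by rewrite sqrtr_gt0.
rewrite -[leLHS]ger0_norm ?invr_ge0 ?sqrtr_ge0// -[leRHS]ger0_norm ?expR_ge0//.
rewrite -ler_sqr ?nnegrE ?normr_ge0// !real_normK ?num_real//.
rewrite exprVn sqr_sqrtr ?(ltW dp)// -expRM_natl.
rewrite -[leLHS]mul1r ler_pdivrMr//.
have := expR_ge1Dx (2 * (a + 4 * a ^+ 2)).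
move/andP: a_bound => [a1 a2] h; have [? ? ? ?] := facts.
have h2 : (1 + 2 * (a + 4 * a ^+ 2)) * (1 - 2 * a) <= expR (2 * (a + 4 * a ^+ 2)) * (1 - 2 * a).
  by rewrite ler_pM2r.
apply: le_trans h2; nra.
Qed.

End SchurStep.

(** * Exponential moments of Gaussian quadratic forms *)

Section ChaosBound.
Variables (R : realType) (I : finType).
Local Notation E := (coords R I).
Variable mu : probability E R.
Hypothesis mu_iid : iid_normal mu.

(** Plays the role of independence from the coordinates in [s], without conditioning. *)
Definition ignores (T : Type) (W : E -> T) (s : seq I) :=
  forall x i g, i \in s -> W (upd x i g) = W x.

Definition qsum (J : Type) (s : seq J) (A : J -> J -> R) (x : J -> R) : R :=
  \sum_(i <- s) \sum_(j <- s) A i j * (x i * x j).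

Lemma qsum_cons (J : Type) i (s : seq J) A x : (forall j, A j i = A i j) ->
  qsum (i :: s) A x =
  A i i * x i ^+ 2 + (2 * \sum_(j <- s) A i j * x j) * x i + qsum s A x.
Proof.
move=> sA; rewrite /qsum big_cons big_cons.
under [X in _ + X]eq_bigr do rewrite big_cons sA.
rewrite big_split /= -expr2 -!addrA; congr (_ + _); rewrite addrA; congr (_ + _).
rewrite mulr_sumr mulr_suml -big_split; apply: eq_bigr => j _ /=.
ring.
Qed.

Lemma eq_qsum (J : eqType) (s : seq J) A x y : {in s, x =1 y} -> qsum s A x = qsum s A y.
Proof.
move=> xy; apply: eq_big_seq => i si; apply: eq_big_seq => j sj.
by rewrite !xy.
Qed.

Lemma upd_same (x : E) i g : upd x i g i = g.
Proof. by rewrite /upd eqxx. Qed.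

Lemma upd_other (x : E) i g j : j != i -> upd x i g j = x j.
Proof. by rewrite /upd => /negbTE ->. Qed.

Lemma measurable_funV d (T : measurableType d) (f : T -> R) :
  measurable_fun setT f -> measurable_fun setT (fun t => (f t)^-1).
Proof.
(* The power function computes the inverse of a nonnegative number, hence the square; the factor
   [f t] restores the sign and gives 0 at a zero. *)
move=> mf; have -> : (fun t => (f t)^-1) = (fun t => f t * (f t ^+ 2) `^ (-1)).
  apply/funext => t; rewrite powR_inv1 ?sqr_ge0//.
  by have [->|f0] := eqVneq (f t) 0; [rewrite invr0 mul0r|field].
apply: measurable_funM => //.
apply: (measurableT_comp (f := fun y : R => y `^ (-1))).
  exact: measurable_powR.
exact: measurable_funX.
Qed.

Lemma measurable_qsum (J : Type) (e : J -> I) (s : seq J) (A : E -> J -> J -> R) :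
  (forall i j, measurable_fun setT (fun x => A x i j)) ->
  measurable_fun setT (fun x : E => qsum s (A x) (x \o e)).
Proof.
move=> mA; do 2 apply: measurable_sum => ?.
by apply: measurable_funM => //; apply: measurable_funM; exact: measurable_coord.
Qed.

(** Induction on [s], for all weights and matrices at once. Integrating out the head coordinate
    multiplies the weight by [expR (a + 4 * a ^+ 2)] and adds the rank-one term [g b b^T] to the
    matrix; neither depends on the remaining coordinates. *)
Lemma integral_expR_qsum (J : eqType) (e : J -> I) (s : seq J) : uniq (map e s) ->
  forall (W : E -> R) (A : E -> J -> J -> R),
  measurable_fun setT W -> (forall x, 0 <= W x) -> ignores W (map e s) ->
  (forall i j, measurable_fun setT (fun x => A x i j)) -> ignores A (map e s) ->
  (forall x i j, A x i j = A x j i) ->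
  (forall x, \sum_(i <- s) \sum_(j <- s) A x i j ^+ 2 <= 1 / 64) ->
  (\int[mu]_x (W x * expR (qsum s (A x) (x \o e)))%:E <=
   \int[mu]_x (W x * expR (\sum_(i <- s) A x i i +
       4 * \sum_(i <- s) \sum_(j <- s) A x i j ^+ 2))%:E)%E.
Proof.
elim: s => [_|i s IH /= /andP[i_s us]] W A mW W0 iW mA iA sA smallA.
  rewrite le_eqVlt; apply/orP; left; apply/eqP; apply: eq_integral => x _.
  by rewrite /qsum !big_nil mulr0 addr0.
pose a x := A x i i; pose b x j := A x i j.
pose g x := 2 / (1 - 2 * a x).
pose A' x j l := A x j l + g x * (b x j * b x l).
pose W' x := W x * expR (a x + 4 * a x ^+ 2).
pose nA x := \sum_(j <- s) \sum_(l <- s) A x j l ^+ 2.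
pose nb x := \sum_(j <- s) b x j ^+ 2.
have nAE x : \sum_(j <- i :: s) \sum_(l <- i :: s) A x j l ^+ 2 =
    a x ^+ 2 + 2 * nb x + nA x.
  rewrite big_cons big_cons; under [X in _ + X]eq_bigr do rewrite big_cons sA.
  by rewrite big_split /= -/(nA x) -/(nb x) -/(a x); ring.
have small x : a x ^+ 2 + 2 * nb x + nA x <= 1 / 64 by rewrite -nAE.
have A'small x : \sum_(j <- s) \sum_(l <- s) A' x j l ^+ 2 <= 1 / 64.
  apply: le_trans (schur_sqr_le erefl erefl erefl (small x)) _.
  have nb0 : 0 <= nb x by apply: sumr_ge0 => ? _; exact: sqr_ge0.
  have a20 : 0 <= a x ^+ 2 by exact: sqr_ge0.
  rewrite -/(nA x) -/(nb x); move: (small x) nb0 a20.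
  by move: (nA x) (nb x) (a x ^+ 2) => y z t ? ? ?; lra.
have mg : measurable_fun setT g.
  apply: measurable_funM => //; apply: measurable_funV.
  by apply: measurable_funB => //; apply: measurable_funM => //; exact: mA.
have msum (D : E -> J -> J -> R) : (forall j l, measurable_fun setT (fun x => D x j l)) ->
    forall r, measurable_fun setT (fun x => \sum_(j <- r) D x j j +
      4 * \sum_(j <- r) \sum_(l <- r) D x j l ^+ 2).
  move=> mD r; apply: measurable_funD; first exact: measurable_sum.
  apply: measurable_funM => //; do 2 apply: measurable_sum => ?.
  exact: measurable_funX.
have mA' j l : measurable_fun setT (fun x => A' x j l).
  apply: measurable_funD => //; apply: measurable_funM => //.
  by apply: measurable_funM; exact: mA.
have mW' : measurable_fun setT W'.
  apply: measurable_funM => //; apply: measurableT_comp => //.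
  apply: measurable_funD; first exact: mA.
  by apply: measurable_funM => //; apply: measurable_funX; exact: mA.
have W'0 x : 0 <= W' x by rewrite mulr_ge0 ?expR_ge0.
have iA' : ignores A' (map e s).
  move=> x j t js; rewrite /A' /g /a /b iA// in_cons js orbT//.
have iW' : ignores W' (map e s).
  by move=> x j t js; rewrite /W' /a iA ?iW// in_cons js orbT.
have sA' x j l : A' x j l = A' x l j by rewrite /A' sA (mulrC (b x j)).
apply: (@le_trans _ _ (\int[mu]_x (W' x * expR (qsum s (A' x) (x \o e)))%:E)%E).
  apply: (resample_le mu_iid (i := e i)).
  - apply/measurable_EFinP; apply: measurable_funM => //.
    by apply: measurableT_comp => //; exact: measurable_qsum.
  - by move=> x; rewrite lee_fin mulr_ge0 ?expR_ge0.
  - apply/measurable_EFinP; apply: measurable_funM => //.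
    by apply: measurableT_comp => //; exact: measurable_qsum.
  move=> x.
  have a12 : a x < 1 / 2.
    have nb0 : 0 <= nb x by apply: sumr_ge0 => ? _; exact: sqr_ge0.
    have nA0 : 0 <= nA x by do 2 apply: sumr_ge0 => ? _; exact: sqr_ge0.
    by move: (small x) nb0 nA0; move: (nA x) (nb x) (a x) => y z t ? ? ?; nra.
  pose c := 2 * \sum_(j <- s) A x i j * x (e j).
  have eqQ t : qsum (i :: s) (A (upd x (e i) t)) (upd x (e i) t \o e) =
      qsum s (A x) (x \o e) + (a x * t ^+ 2 + c * t).
    rewrite iA ?mem_head// qsum_cons// /= upd_same addrC; congr (_ + (_ + _ * _ * _)).
      apply: eq_qsum => j js; rewrite /= upd_other//.
      by apply: contraNneq i_s => <-; exact: map_f.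
    apply: eq_big_seq => j js; rewrite /= upd_other//.
    by apply: contraNneq i_s => <-; exact: map_f.
  under eq_integral => t _.
    rewrite iW ?mem_head// eqQ expRD mulrA EFinM.
    over.
  rewrite ge0_integralZl//; last 2 first.
  - apply/measurable_EFinP; apply: measurableT_comp => //.
    by apply: measurable_funD; apply: measurable_funM.
  - by rewrite lee_fin mulr_ge0 ?expR_ge0.
  rewrite integral_normal_expR_quad// -EFinM lee_fin.
  (* With [c = 2 * (b . x)], the Gaussian term [c ^+ 2 / (2 * (1 - 2 * a))] equals
     [g * (b . x) ^+ 2], the quadratic form of the rank-one update. *)
  have -> : qsum s (A' x) (x \o e) = qsum s (A x) (x \o e) + c ^+ 2 / (2 * (1 - 2 * a x)).
    rewrite /qsum /A'; under eq_bigr do under eq_bigr do rewrite mulrDl.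
    under eq_bigr do rewrite big_split; rewrite big_split /=; congr (_ + _).
    have -> : c ^+ 2 / (2 * (1 - 2 * a x)) =
        g x * ((\sum_(j <- s) b x j * x (e j)) * (\sum_(j <- s) b x j * x (e j))).
      rewrite /c /g /b; move: a12; move: (a x) => t a12.
      by field; rewrite gt_eqF//; lra.
    rewrite mulr_suml mulr_sumr; apply: eq_bigr => j _.
    rewrite !mulr_sumr; apply: eq_bigr => l _ /=; ring.
  move: (c ^+ 2 / (2 * (1 - 2 * a x))) => r.
  rewrite /W' (expRD (qsum _ _ _)) -!mulrA ler_wpM2l//.
  rewrite [leLHS]mulrA [leRHS]mulrC ler_wpM2l ?mulr_ge0 ?expR_ge0//.
  exact: inv_sqrt_le_expR (small x).
apply: le_trans (IH us W' A' mW' W'0 iW' mA' iA' sA' A'small) _.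
apply: ge0_le_integral => //.
- by move=> x _; rewrite lee_fin mulr_ge0 ?expR_ge0.
- apply/measurable_EFinP; apply: measurable_funM => //.
  by apply: measurableT_comp => //; exact: msum.
- apply/measurable_EFinP; apply: measurable_funM => //.
  by apply: measurableT_comp => //; exact: msum.
- move=> x _; rewrite lee_fin /W' -mulrA ler_wpM2l// -expRD ler_expR nAE.
  rewrite big_cons -/(a x).
  have := schur_trace_le erefl erefl erefl (small x).
  rewrite -/(g x) => h.
  rewrite -!addrA lerD2l.
  apply: (@le_trans _ _
    (4 * a x ^+ 2 + (\sum_(j <- s) A x j j + 4 * (2 * nb x + nA x)))).
    by rewrite lerD2l.
  by move: (\sum_(j <- s) A x j j) (nA x) (nb x) (a x ^+ 2) => y z t u; lra.
Qed.

End ChaosBound.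

(** * Gaussian matrices and the decay of the residual *)
Definition measurable_mx (R : realType) d (T : measurableType d) m n
    (F : T -> 'M[R]_(m, n)) :=
  forall i j, measurable_fun setT (fun t => F t i j).

Section MeasurableMatrices.
Variables (R : realType) (d : measure_display) (T : measurableType d).

Lemma measurable_mxM m n p (F : T -> 'M[R]_(m, n)) (G : T -> 'M[R]_(n, p)) :
  measurable_mx F -> measurable_mx G -> measurable_mx (fun t => F t *m G t).
Proof.
move=> mF mG i j; under eq_fun do rewrite mxE.
by apply: measurable_sum => l; exact: measurable_funM.
Qed.

Lemma measurable_mxT m n (F : T -> 'M[R]_(m, n)) :
  measurable_mx F -> measurable_mx (fun t => (F t)^T).
Proof. by move=> mF i j; under eq_fun do rewrite mxE; exact: mF. Qed.

Lemma measurable_mxB m n (F G : T -> 'M[R]_(m, n)) :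
  measurable_mx F -> measurable_mx G -> measurable_mx (fun t => F t - G t).
Proof.
move=> mF mG i j; under eq_fun do rewrite !mxE.
exact: measurable_funB.
Qed.

Lemma measurable_mxZ m n (c : T -> R) (F : T -> 'M[R]_(m, n)) :
  measurable_fun setT c -> measurable_mx F -> measurable_mx (fun t => c t *: F t).
Proof.
move=> mc mF i j; under eq_fun do rewrite !mxE.
exact: measurable_funM.
Qed.

Lemma measurable_mx_col m n (F : T -> 'M[R]_(m, n)) j :
  measurable_mx F -> measurable_mx (fun t => col j (F t)).
Proof. by move=> mF i l; under eq_fun do rewrite mxE; exact: mF. Qed.

Lemma measurable_tr n (F : T -> 'M[R]_n) :
  measurable_mx F -> measurable_fun setT (fun t => \tr (F t)).
Proof. by move=> mF; apply: measurable_sum. Qed.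

Lemma measurable_frob2 n (F : T -> 'M[R]_n) :
  measurable_mx F -> measurable_fun setT (fun t => frob2 (F t)).
Proof.
by move=> mF; do 2 apply: measurable_sum => ?; exact: measurable_funX.
Qed.

Lemma measurable_bform n (F : T -> 'M[R]_n) u v :
  measurable_mx F -> measurable_mx u -> measurable_mx v ->
  measurable_fun setT (fun t => bform (F t) (u t) (v t)).
Proof.
move=> mF mu mv; apply: measurable_mxM => //; apply: measurable_mxM => //.
exact: measurable_mxT.
Qed.

Lemma measurable_residual n k (B : T -> 'M[R]_n) (Om : T -> 'M[R]_(n, k)) s :
  measurable_mx B -> measurable_mx Om ->
  measurable_mx (fun t => residual (B t) (Om t) s).
Proof.
move=> mB mOm; elim/last_ind: s => [|s j IH] //.
under eq_fun do rewrite residual_rcons.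
have mc := measurable_mx_col j mOm.
apply: measurable_mxB => //; apply: measurable_mxZ.
  exact/measurable_funV/measurable_bform.
have my := measurable_mxM IH mc.
by apply: measurable_mxM => //; exact: measurable_mxT.
Qed.

End MeasurableMatrices.

Section GaussianMatrices.
Variables (R : realType) (n k : nat).
Local Notation I := (('I_n * 'I_k) + ('I_n * 'I_k))%type.
Local Notation E := (coords R I).
Variable mu : probability E R.
Hypothesis mu_iid : iid_normal mu.

Lemma integral_expR_bform (e : 'I_n -> I) (W : E -> R) (M : E -> 'M[R]_n) :
  injective e ->
  measurable_fun setT W -> (forall x, 0 <= W x) -> ignores W (codom e) ->
  measurable_mx M -> ignores M (codom e) -> (forall x, (M x)^T = M x) ->
  (forall x, frob2 (M x) <= 1 / 64) ->
  (\int[mu]_x (W x * expR (bform (M x) (\col_i x (e i)) (\col_i x (e i))))%:E <=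
   \int[mu]_x (W x * expR (\tr (M x) + 4 * frob2 (M x)))%:E)%E.
Proof.
move=> inj_e mW W0 iW mM iM sM smallM.
pose A x i j := M x i j.
have codomE : codom e = map e (enum 'I_n) by [].
have sE : enum 'I_n = index_enum 'I_n by rewrite enumT /index_enum unlock.
have us : uniq (map e (index_enum 'I_n)) by rewrite map_inj_uniq ?index_enum_uniq.
have := integral_expR_qsum mu_iid us (A := A) mW W0.
rewrite -sE -codomE => /(_ iW mM).
have iA : ignores A (codom e) by move=> x i g ie; rewrite /A iM.
have sA x i j : A x i j = A x j i by rewrite /A -[in RHS]sM mxE.
move=> /(_ iA sA); rewrite sE => /(_ smallM).
congr (_ <= _)%E; apply: eq_integral => x _.
rewrite bformE /qsum; congr (_ * expR _)%:E.
by apply: eq_bigr => i _; apply: eq_bigr => j _; rewrite !mxE.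
Qed.

Definition psi_of (x : E) : 'M[R]_(n, k) := \matrix_(i, j) x (inl (i, j)).
Definition om_of (x : E) : 'M[R]_(n, k) := \matrix_(i, j) x (inr (i, j)).

Lemma measurable_psi_of : measurable_mx psi_of.
Proof. by move=> i j; under eq_fun do rewrite mxE; exact: measurable_coord. Qed.

Lemma measurable_om_of : measurable_mx om_of.
Proof. by move=> i j; under eq_fun do rewrite mxE; exact: measurable_coord. Qed.

Lemma om_of_upd x p g : om_of (upd x (inl p) g) = om_of x.
Proof. by apply/matrixP => i j; rewrite !mxE. Qed.

Lemma col_om_of_upd x i j l g : l != j ->
  col l (om_of (upd x (inr (i, j)) g)) = col l (om_of x).
Proof.
move=> lj; apply/colP => i'; rewrite !mxE upd_other//.
by apply: contraNneq lj => -[_ ->].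
Qed.

Lemma col_psi_of_upd x i j l g : l != j ->
  col l (psi_of (upd x (inl (i, j)) g)) = col l (psi_of x).
Proof.
move=> lj; apply/colP => i'; rewrite !mxE upd_other//.
by apply: contraNneq lj => -[_ ->].
Qed.

(** The residual reads only the columns already used, so a new column is independent of it. *)
Lemma residual_upd B x i j g s : j \notin s ->
  residual B (om_of (upd x (inr (i, j)) g)) s = residual B (om_of x) s.
Proof.
elim/last_ind: s => [|s l IH] //; rewrite mem_rcons inE negb_or => /andP[jl js].
by rewrite !residual_rcons IH// col_om_of_upd// eq_sym.
Qed.

End GaussianMatrices.

(** * The potential [exp (- 64 / F)] and its behaviour under one elimination *)

Section Potential.
Variable R : realType.
Implicit Types x y F : R.

(* The convention at [0] is the limit value; [expR (- 64 / 0)] would be [1]. *)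
Definition potential F : R := if F == 0 then 0 else expR (- 64 / F).

Lemma potential_ge0 F : 0 <= potential F.
Proof. by rewrite /potential; case: ifP => // _; exact: expR_ge0. Qed.

Lemma potential_le1 F : 0 <= F -> potential F <= 1.
Proof.
rewrite /potential => F0; case: ifP => [_|_]; first exact: ler01.
by rewrite -expR0 ler_expR mulNr oppr_le0 divr_ge0.
Qed.

Lemma potential_homo F F' : 0 <= F' -> F' <= F -> potential F' <= potential F.
Proof.
rewrite /potential => F'0 F'F; have [//|F'_neq0] := eqVneq F' 0.
  by case: ifP => // _; exact: expR_ge0.
have F'p : 0 < F' by rewrite lt_def F'_neq0.
have Fp : 0 < F by exact: lt_le_trans F'F.
by rewrite gt_eqF// ler_expR !mulNr lerN2 ler_pM2l// lef_pV2.
Qed.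

Lemma expRN1_le2 : expR (- 1) <= 1 / 2 :> R.
Proof.
have h : (2 : R) <= expR 1 by have := expR_ge1Dx (1 : R); lra.
rewrite expRN -[leLHS]mul1r ler_pdivrMr ?expR_gt0//.
by move: h; lra.
Qed.

(** The decrease of [F] raises [64 / F] by at least 1, because [(64 / F + 1) * (F - F ^+ 2 / 64) =
    64 - F ^+ 2 / 64 <= 64]; and [expR (- 1) <= 1 / 2]. *)
Lemma potential_contract F F' : 0 <= F' -> F' <= F - F ^+ 2 / 64 ->
  potential F' <= potential F / 2.
Proof.
move=> F'0 F'F; rewrite {1}/potential.
have [_|F'_neq0] := eqVneq F' 0; first by rewrite divr_ge0// potential_ge0.
have F'p : 0 < F' by rewrite lt_def F'_neq0.
have F2 : 0 <= F ^+ 2 by exact: sqr_ge0.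
have Fp : 0 < F by move: F'p F'F F2; lra.
rewrite /potential gt_eqF//.
have h : - 64 / F' <= - 64 / F - 1.
  rewrite ler_pdivrMr// mulrBl mul1r.
  have -> : - 64 / F * F' - F' = - (64 / F + 1) * F' by lra.
  have h2 : (64 / F + 1) * F' <= (64 / F + 1) * (F - F ^+ 2 / 64).
    by rewrite ler_pM2l// addr_gt0// divr_gt0.
  have h3 : (64 / F + 1) * (F - F ^+ 2 / 64) = 64 - F ^+ 2 / 64.
    by field; rewrite gt_eqF.
  by move: h2; rewrite h3; move: F2; lra.
apply: (@le_trans _ _ (expR (- 64 / F - 1))); first by rewrite ler_expR.
rewrite expRD ler_wpM2l ?expR_ge0//; have := expRN1_le2; lra.
Qed.

(* With [x = w^T N^2 w / F] and [y = w^T N w] the bound reads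
   [potential F * (1 - h / 2)], where [h = 9/8 - exp (- x/8) - exp (y/8) / 8 <= 1]
   can only be positive if [y / 8 < x], in which case [F' <= F - F^2 / 64]. *)
Lemma potential_eliminate n (N : 'M[R]_n) (w : 'cV[R]_n) :
  sym_psd N ->
  potential (frob2 (eliminate N w)) <=
  7 / 16 * potential (frob2 N) +
  1 / 2 * (potential (frob2 N) *
           expR (- (8 * frob2 N)^-1 * bform (N *m N) w w)) +
  1 / 16 * (potential (frob2 N) * expR (1 / 8 * bform N w w)).
Proof.
move=> pN; set F := frob2 N; set q1 := bform N w w; set q2 := bform (N *m N) w w.
have sN : N^T = N by case: pN.
have q10 : 0 <= q1 by exact: bform_psd.
have q20 : 0 <= q2 by apply: bform_psd; exact: psd_sqr.
have F0 : 0 <= F by exact: frob2_ge0.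
set F' := frob2 _; have F'0 : 0 <= F' by exact: frob2_ge0.
have dec : F' <= F - (q2 / q1) ^+ 2 by exact: frob2_eliminate.
have sq0 : 0 <= (q2 / q1) ^+ 2 by exact: sqr_ge0.
have F'F : F' <= F by move: dec sq0; lra.
have [F_eq0|F_neq0] := eqVneq F 0.
  have -> : F' = 0 by apply/eqP; rewrite eq_le F'0 andbT -F_eq0.
  by rewrite F_eq0 /potential eqxx !(mul0r, mulr0) !addr0.
have Fp : 0 < F by rewrite lt_def F_neq0.
pose x := q2 / F.
have -> : - (8 * F)^-1 * q2 = - (x / 8) by rewrite /x; field.
have e1 := expR_ge1Dx (- (x / 8)).
have e2 := expR_ge1Dx (1 / 8 * q1).
have e1p := expR_gt0 (- (x / 8)).
have P0 := potential_ge0 F.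
move: (potential_homo F'0 F'F) => mono.
(* If [h <= 0], monotonicity of the potential suffices. Otherwise [1 + y <= expR y] in both
   exponentials forces [q1 / 8 < x]. *)
have [hle|hgt] := leP (1 + 1 / 8) (expR (- (x / 8)) + 1 / 8 * expR (1 / 8 * q1)).
  apply: le_trans mono _; move: hle P0 e1p e2.
  move: (expR (- _)) (expR (_ * _)) (potential F) => u v P; nra.
have xq : q1 / 8 < x by move: hgt e1 e2; lra.
(* Half the potential is enough, since [7/16 + 1/16 = 1/2] and the last exponential is at least
   1. *)
apply: (@le_trans _ _ (potential F / 2)).
  apply: potential_contract => //; apply: le_trans dec _; rewrite lerD2l lerN2.
  have q1p : 0 < q1.
    rewrite lt_def q10 andbT; apply/negP => /eqP q1_eq0.
    have Nw : N *m w = 0 by exact: psd_ker.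
    have q2_eq0 : q2 = 0 by rewrite /q2 /bform -mulmxA -[_ *m _ *m w]mulmxA Nw !mulmx0 mxE.
    by move: xq; rewrite /x q1_eq0 q2_eq0 !mul0r ltxx.
  have -> : q2 / q1 = F * (x / q1) by rewrite /x; field; rewrite !gt_eqF.
  rewrite exprMn ler_wpM2l ?sqr_ge0//.
  have : 1 / 8 <= x / q1 by rewrite ler_pdivlMr//; move: xq; lra.
  by move: (x / q1) => y; nra.
have e2p : 1 <= expR (1 / 8 * q1) by move: e2 q10; lra.
move: e1p e2p P0; move: (expR (- _)) (expR (_ * _)) (potential F) => u v P; nra.
Qed.

End Potential.

Lemma integral_EFin_le d (T : measurableType d) (R : realType)
    (mu : {measure set T -> \bar R}) (f g : T -> R) :
  measurable_fun setT f -> measurable_fun setT g ->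
  (forall x, 0 <= f x) -> (forall x, f x <= g x) ->
  (\int[mu]_x (f x)%:E <= \int[mu]_x (g x)%:E)%E.
Proof.
move=> mf mg f0 fg; apply: ge0_le_integral.
- exact: measurableT.
- by move=> x _; rewrite lee_fin.
- exact/measurable_EFinP.
- exact/measurable_EFinP.
- by move=> x _; rewrite lee_fin.
Qed.

Lemma ge0_integral_EFinD d (T : measurableType d) (R : realType)
    (mu : {measure set T -> \bar R}) (f g : T -> R) :
  measurable_fun setT f -> measurable_fun setT g ->
  (forall x, 0 <= f x) -> (forall x, 0 <= g x) ->
  (\int[mu]_x (f x + g x)%:E = \int[mu]_x (f x)%:E + \int[mu]_x (g x)%:E)%E.
Proof.
move=> mf mg f0 g0; under eq_integral do rewrite EFinD.
apply: ge0_integralD.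
- exact: measurableT.
- by move=> x _; rewrite lee_fin.
- exact/measurable_EFinP.
- by move=> x _; rewrite lee_fin.
- exact/measurable_EFinP.
Qed.

Lemma ge0_integral_EFinZl d (T : measurableType d) (R : realType)
    (mu : {measure set T -> \bar R}) (c : R) (f : T -> R) :
  0 <= c -> measurable_fun setT f -> (forall x, 0 <= f x) ->
  (\int[mu]_x (c * f x)%:E = c%:E * \int[mu]_x (f x)%:E)%E.
Proof.
move=> c0 mf f0; under eq_integral do rewrite EFinM.
apply: ge0_integralZl.
- exact: measurableT.
- exact/measurable_EFinP.
- by move=> x _; rewrite lee_fin.
- by rewrite lee_fin.
Qed.

Lemma integral_EFinD_le d (T : measurableType d) (R : realType)
    (mu : {measure set T -> \bar R}) (f f' g g' : T -> R) :
  measurable_fun setT f -> (forall x, 0 <= f x) ->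
  measurable_fun setT f' -> (forall x, 0 <= f' x) ->
  measurable_fun setT g -> (forall x, 0 <= g x) ->
  measurable_fun setT g' -> (forall x, 0 <= g' x) ->
  (\int[mu]_x (f x)%:E <= \int[mu]_x (f' x)%:E ->
   \int[mu]_x (g x)%:E <= \int[mu]_x (g' x)%:E ->
   \int[mu]_x (f x + g x)%:E <= \int[mu]_x (f' x + g' x)%:E)%E.
Proof.
move=> mf f0 mf' f'0 mg g0 mg' g'0 ff' gg'.
by rewrite !ge0_integral_EFinD//; exact: leeD.
Qed.

Lemma measurable_potential (R : realType) d (T : measurableType d) (F : T -> R) :
  measurable_fun setT F -> measurable_fun setT (fun t => potential (F t)).
Proof.
move=> mF; apply: measurable_fun_ifT => //.
  exact: measurable_fun_eqr.
apply: measurableT_comp => //; apply: measurable_funM => //.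
exact: measurable_funV.
Qed.

(** * Geometric decay of the expected potential *)

Section Decay.
Variables (R : realType) (n k : nat).
Local Notation I := (('I_n * 'I_k) + ('I_n * 'I_k))%type.
Local Notation E := (coords R I).
Variable mu : probability E R.
Hypothesis mu_iid : iid_normal mu.
Variable B : 'M[R]_n.
Hypotheses (pB : sym_psd B) (trB : \tr B <= 1).

Let N s (x : E) := residual B (om_of x) s.
Let pN s x : sym_psd (N s x). Proof. exact: residual_psd. Qed.
Let sN s x : (N s x)^T = N s x. Proof. by case: (pN s x). Qed.
Let trN s x : \tr (N s x) <= 1. Proof. exact: le_trans (tr_residual _ _ pB) trB. Qed.
Let mN s : measurable_mx (N s).
Proof. by apply: measurable_residual => //; exact: measurable_om_of. Qed.
Let P s x := potential (frob2 (N s x)).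
Let mP s : measurable_fun setT (P s).
Proof. exact/measurable_potential/measurable_frob2. Qed.
Let P0 s x : 0 <= P s x. Proof. exact: potential_ge0. Qed.

Lemma frob2_residual_le1 s (x : E) : frob2 (residual B (om_of x) s) <= 1.
Proof.
apply: le_trans (frob2_le_tr (pN s x)) _.
by rewrite -[leRHS](expr1n _ 2) ler_sqr ?nnegrE// psd_tr_ge0.
Qed.

(** Averages [potential_eliminate] over the fresh column [j]. The forms [M1] and [M2] have traces
    [- 1/8] and at most [1/8], and [4 * frob2 <= 1/16], so the factor is at most [7/16 + 1/2 * 16/17
    + 1/16 * 16/13 < 99/100]. *)
Lemma potential_decay s j : j \notin s ->
  (\int[mu]_x (potential (frob2 (residual B (om_of x) (rcons s j))))%:E <=
   (99 / 100)%:E *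
   \int[mu]_x (potential (frob2 (residual B (om_of x) s)))%:E)%E.
Proof.
move=> js.
pose e (i : 'I_n) : I := inr (i, j).
have inj_e : injective e by move=> i i' [].
have colE x : col j (om_of x) = \col_i x (e i).
  by apply/colP => i; rewrite !mxE.
have iN : ignores (N s) (codom e).
  by move=> x _ g /codomP[i ->]; exact: residual_upd.
pose M1 x := - (8 * frob2 (N s x))^-1 *: (N s x *m N s x).
pose M2 x := (1 / 8) *: N s x.
have mNN : measurable_mx (fun x => N s x *m N s x) by exact: measurable_mxM.
have mF : measurable_fun setT (fun x => frob2 (N s x)) by exact: measurable_frob2.
have mM1 : measurable_mx M1.
  apply: measurable_mxZ => //; apply: measurable_funN; apply: measurable_funV.
  exact: measurable_funM.
have mM2 : measurable_mx M2 by exact: measurable_mxZ.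
have iM1 : ignores M1 (codom e) by move=> x i g ie; rewrite /M1 iN.
have iM2 : ignores M2 (codom e) by move=> x i g ie; rewrite /M2 iN.
have iP : ignores (P s) (codom e) by move=> x i g ie; rewrite /P iN.
have sM1 x : (M1 x)^T = M1 x by rewrite /M1 linearZ /= trmx_mul sN.
have sM2 x : (M2 x)^T = M2 x by rewrite /M2 linearZ /= sN.
(* The square of [N] is positive semi-definite of trace [F], so its squared Frobenius norm is at
   most [F ^+ 2]. *)
have smallM1 x : frob2 (M1 x) <= 1 / 64.
  rewrite frob2Z sqrrN exprVn exprMn.
  have h := frob2_le_tr (psd_sqr (sN s x)); rewrite -frob2_trE// in h.
  have [->|F0] := eqVneq (frob2 (N s x)) 0.
    by rewrite expr0n /= mulr0 invr0 mul0r.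
  have Fp : 0 < frob2 (N s x) by rewrite lt_def F0 frob2_ge0.
  rewrite mulrC ler_pdivrMr ?mulr_gt0// ?exprn_gt0//.
  by apply: le_trans h _; lra.
have smallM2 x : frob2 (M2 x) <= 1 / 64.
  rewrite frob2Z; have := frob2_residual_le1 s x; rewrite -/(N s x).
  by move: (frob2 _) => F; lra.
pose W c x := c * P s x.
have mW c : measurable_fun setT (W c) by exact: measurable_funM.
have W0 c x : 0 <= c -> 0 <= W c x by move=> c0; rewrite mulr_ge0.
have iW c : ignores (W c) (codom e) by move=> x i g ie; rewrite /W iP.
have half0 : 0 <= 1 / 2 :> R by lra.
have sxth0 : 0 <= 1 / 16 :> R by lra.
have b1 := integral_expR_bform mu_iid inj_e (mW (1 / 2)) (fun x => W0 _ x half0)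
  (iW _) mM1 iM1 sM1 smallM1.
have b2 := integral_expR_bform mu_iid inj_e (mW (1 / 16)) (fun x => W0 _ x sxth0)
  (iW _) mM2 iM2 sM2 smallM2.
have mcol : measurable_mx (fun x : E => \col_i x (e i)).
  by move=> i l; under eq_fun do rewrite mxE; exact: measurable_coord.
have mexp (M : E -> 'M[R]_n) c : measurable_mx M -> measurable_fun setT
    (fun x => W c x * expR (bform (M x) (\col_i x (e i)) (\col_i x (e i)))).
  move=> mM; apply: measurable_funM => //; apply: measurableT_comp => //.
  exact: measurable_bform.
have mexp' (M : E -> 'M[R]_n) c : measurable_mx M -> measurable_fun setT
    (fun x => W c x * expR (\tr (M x) + 4 * frob2 (M x))).
  move=> mM; apply: measurable_funM => //; apply: measurableT_comp => //.
  apply: measurable_funD; first exact: measurable_tr.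
  by apply: measurable_funM => //; exact: measurable_frob2.
pose G x := W (7 / 16) x +
  W (1 / 2) x * expR (bform (M1 x) (\col_i x (e i)) (\col_i x (e i))) +
  W (1 / 16) x * expR (bform (M2 x) (\col_i x (e i)) (\col_i x (e i))).
pose G' x := W (7 / 16) x +
  W (1 / 2) x * expR (\tr (M1 x) + 4 * frob2 (M1 x)) +
  W (1 / 16) x * expR (\tr (M2 x) + 4 * frob2 (M2 x)).
have mG : measurable_fun setT G.
  by apply: measurable_funD; [apply: measurable_funD => //|]; exact: mexp.
have mG' : measurable_fun setT G'.
  by apply: measurable_funD; [apply: measurable_funD => //|]; exact: mexp'.
have W7 x : 0 <= W (7 / 16) x by apply: W0; lra.
have G0 x : 0 <= G x.
  by rewrite !addr_ge0// mulr_ge0 ?expR_ge0// W0.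
have G'0 x : 0 <= G' x.
  by rewrite !addr_ge0// mulr_ge0 ?expR_ge0// W0.
apply: (@le_trans _ _ (\int[mu]_x (G x)%:E)%E).
  apply: integral_EFin_le => [|||x]; [exact: (mP (rcons s j))|exact: mG| |].
    by move=> x; exact: (P0 (rcons s j)).
  rewrite residual_rcons colE.
  apply: le_trans (potential_eliminate _ (pN s x)) _.
  by rewrite /G /W /M1 /M2 !bformZ -!mulrA.
apply: (@le_trans _ _ (\int[mu]_x (G' x)%:E)%E).
  pose ex (M : E -> 'M[R]_n) c x :=
    W c x * expR (bform (M x) (\col_i x (e i)) (\col_i x (e i))).
  pose tr (M : E -> 'M[R]_n) c x :=
    W c x * expR (\tr (M x) + 4 * frob2 (M x)).
  have mex (M : E -> 'M[R]_n) c : measurable_mx M -> measurable_fun setT (ex M c).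
    exact: mexp.
  have mtr (M : E -> 'M[R]_n) c : measurable_mx M -> measurable_fun setT (tr M c).
    exact: mexp'.
  have ex0 (M : E -> 'M[R]_n) c x : 0 <= c -> 0 <= ex M c x.
    by move=> c0; rewrite mulr_ge0 ?expR_ge0 ?W0.
  have tr0 (M : E -> 'M[R]_n) c x : 0 <= c -> 0 <= tr M c x.
    by move=> c0; rewrite mulr_ge0 ?expR_ge0 ?W0.
  apply: (@integral_EFinD_le _ _ _ mu
    (fun x => W (7 / 16) x + ex M1 (1 / 2) x)
    (fun x => W (7 / 16) x + tr M1 (1 / 2) x)
    (ex M2 (1 / 16)) (tr M2 (1 / 16))).
  - by apply: measurable_funD; [exact: mW|exact: mex].
  - by move=> x; rewrite addr_ge0 ?ex0 ?W7.
  - by apply: measurable_funD; [exact: mW|exact: mtr].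
  - by move=> x; rewrite addr_ge0 ?tr0 ?W7.
  - exact: mex.
  - by move=> x; exact: ex0.
  - exact: mtr.
  - by move=> x; exact: tr0.
  - apply: (@integral_EFinD_le _ _ _ mu (W (7 / 16)) (W (7 / 16))
      (ex M1 (1 / 2)) (tr M1 (1 / 2))).
    + exact: mW.
    + exact: W7.
    + exact: mW.
    + exact: W7.
    + exact: mex.
    + by move=> x; exact: ex0.
    + exact: mtr.
    + by move=> x; exact: tr0.
    + exact: lexx.
    + exact: b1.
  - exact: b2.
rewrite -(ge0_integral_EFinZl _ _ (mP s) (P0 s)); last by lra.
apply: integral_EFin_le => [|||x]; [exact: mG'|exact: (mW (99 / 100))|exact: G'0|].
rewrite -/(P s x) /G' /W.
have [F0|F_neq0] := eqVneq (frob2 (N s x)) 0.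
  by rewrite /P F0 /potential eqxx !(mulr0, mul0r) !addr0.
have trM1 : \tr (M1 x) = - (1 / 8).
  by rewrite mxtraceZ -frob2_trE//; field.
have trM2 : \tr (M2 x) <= 1 / 8.
  by rewrite mxtraceZ; have := trN s x; move: (\tr _) => y; lra.
have e1 : expR (\tr (M1 x) + 4 * frob2 (M1 x)) <= 16 / 17.
  apply: (@le_trans _ _ (expR (- (1 / 16)))).
    by rewrite ler_expR trM1; move: (smallM1 x); move: (frob2 _) => y; lra.
  rewrite expRN -[leLHS]mul1r ler_pdivrMr ?expR_gt0//.
  by have := expR_ge1Dx (1 / 16 : R); move: (expR _) => y; lra.
have e2 : expR (\tr (M2 x) + 4 * frob2 (M2 x)) <= 16 / 13.
  apply: (@le_trans _ _ (expR (3 / 16))).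
    rewrite ler_expR; move: trM2 (smallM2 x).
    by move: (frob2 _) (\tr _) => y z; lra.
  have h := expR_ge1Dx (- (3 / 16) : R).
  rewrite -[leLHS]invrK -expRN -[leLHS]mul1r ler_pdivrMr ?expR_gt0//.
  by move: h; move: (expR _) => y; lra.
move: (expR _) (expR _) (P s x) (P0 s x) e1 e2 => u v p p0 e1 e2.
nra.
Qed.

Lemma integral_potential_residual s : uniq s ->
  (\int[mu]_x (potential (frob2 (residual B (om_of x) s)))%:E <=
   ((99 / 100) ^+ size s)%:E)%E.
Proof.
elim/last_ind: s => [_|s j IH].
  apply: (@le_trans _ _ (\int[mu]_x (cst 1 x))%E); last first.
    by rewrite integral_cst//= probability_setT mul1e expr0.
  apply: integral_EFin_le => [|||x]; [exact: (mP [::])|exact: measurable_cst| |].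
    by move=> x; exact: (P0 [::]).
  by rewrite potential_le1// frob2_ge0.
rewrite rcons_uniq size_rcons => /andP[js us].
apply: le_trans (potential_decay js) _.
by rewrite exprS (EFinM (99 / 100)); apply: lee_wpmul2l; [rewrite lee_fin; lra|exact: IH].
Qed.

End Decay.

(** * The exponential moment of the error *)
Section Hutchinson.
Variables (R : realType) (n k : nat).
Local Notation I := (('I_n * 'I_k) + ('I_n * 'I_k))%type.
Local Notation E := (coords R I).
Variable mu : probability E R.
Hypothesis mu_iid : iid_normal mu.

(** Over all [k] columns this is [k] times the Hutchinson error. Keeping a list of columns permits
    induction. *)
Definition centered (N : 'M[R]_n) (Psi : 'M[R]_(n, k)) (s : seq 'I_k) : R :=
  \sum_(j <- s) (bform N (col j Psi) (col j Psi) - \tr N).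

Lemma measurable_centered d (T : measurableType d) (N : T -> 'M[R]_n)
    (Psi : T -> 'M[R]_(n, k)) s : measurable_mx N -> measurable_mx Psi ->
  measurable_fun setT (fun x => centered (N x) (Psi x) s).
Proof.
move=> mN mPsi; apply: measurable_sum => j; apply: measurable_funB.
  by apply: measurable_bform => //; exact: measurable_mx_col.
exact: measurable_tr.
Qed.

Lemma centeredZ c N Psi s : centered (c *: N) Psi s = c * centered N Psi s.
Proof.
rewrite /centered mulr_sumr; apply: eq_bigr => j _.
by rewrite bformZ mxtraceZ mulrBr.
Qed.

Lemma centered_upd N (x : E) i j g s : j \notin s ->
  centered N (psi_of (upd x (inl (i, j)) g)) s = centered N (psi_of x) s.
Proof.
move=> js; apply: eq_big_seq => l ls; rewrite col_psi_of_upd//.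
by apply: contraNneq js => <-.
Qed.

(** Column by column: the centering cancels the term [c * \tr N] of the quadratic-form bound,
    leaving [4 * c ^+ 2 * frob2 N], which is absorbed into [G] before the next column. *)
Lemma integral_expR_centered (c : R) (N : E -> 'M[R]_n) (s : seq 'I_k) :
  c ^+ 2 <= 1 / 64 ->
  measurable_mx N -> (forall x, (N x)^T = N x) -> (forall x, frob2 (N x) <= 1) ->
  (forall x p g, N (upd x (inl p) g) = N x) -> uniq s ->
  forall G : E -> R, measurable_fun setT G ->
  (forall x p g, G (upd x (inl p) g) = G x) ->
  (\int[mu]_x (expR (G x + c * centered (N x) (psi_of x) s))%:E <=
   \int[mu]_x (expR (G x + 4 * c ^+ 2 * (size s)%:R * frob2 (N x)))%:E)%E.
Proof.
move=> c2 mN sN N1 iN; elim: s => [_|j s IH] /=.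
  move=> G _ _; rewrite le_eqVlt; apply/orP; left; apply/eqP.
  by apply: eq_integral => x _; rewrite /centered big_nil mulr0 mulr0 mul0r.
move=> /andP[js us] G mG iG.
pose e (i : 'I_n) : I := inl (i, j).
have inj_e : injective e by move=> i i' [].
have colE x : col j (psi_of x) = \col_i x (e i).
  by apply/colP => i; rewrite !mxE.
pose M x := c *: N x.
have mM : measurable_mx M by exact: measurable_mxZ.
have sM x : (M x)^T = M x by rewrite /M linearZ /= sN.
have iM : ignores M (codom e) by move=> x _ g /codomP[i ->]; rewrite /M iN.
have smallM x : frob2 (M x) <= 1 / 64.
  rewrite frob2Z; have := N1 x; have := frob2_ge0 (N x).
  by move: (frob2 _) (c ^+ 2) c2 (sqr_ge0 c) => F d; nra.
pose W x := expR (G x + c * centered (N x) (psi_of x) s - c * \tr (N x)).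
have mW : measurable_fun setT W.
  apply: measurableT_comp => //; apply: measurable_funB.
    apply: measurable_funD => //; apply: measurable_funM => //.
    by apply: measurable_centered => //; exact: measurable_psi_of.
  by apply: measurable_funM => //; exact: measurable_tr.
have iW : ignores W (codom e).
  by move=> x _ g /codomP[i ->]; rewrite /W iG iN centered_upd.
have := integral_expR_bform mu_iid inj_e mW (fun x => expR_ge0 _) iW mM iM sM smallM.
have -> : (\int[mu]_x (W x * expR (bform (M x) (\col_i x (e i)) (\col_i x (e i))))%:E =
    \int[mu]_x (expR (G x + c * centered (N x) (psi_of x) (j :: s)))%:E)%E.
  apply: eq_integral => x _; rewrite /W -expRD /M bformZ -colE.
  by rewrite /centered big_cons; congr (expR _)%:E; ring.
move=> /le_trans; apply.
pose G' x := G x + 4 * c ^+ 2 * frob2 (N x).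
have mG' : measurable_fun setT G'.
  by apply: measurable_funD => //; apply: measurable_funM => //; exact: measurable_frob2.
have iG' x p g : G' (upd x (inl p) g) = G' x by rewrite /G' iG iN.
have := IH us G' mG' iG'.
congr (_ <= _)%E; apply: eq_integral => x _; congr EFin.
  rewrite /W -expRD /M mxtraceZ frob2Z /G'; congr expR; ring.
by rewrite /G'; congr expR; rewrite -natr1; ring.
Qed.

End Hutchinson.

Section ExponentialMoment.
Variables (R : realType) (n k : nat).
Local Notation I := (('I_n * 'I_k) + ('I_n * 'I_k))%type.
Local Notation E := (coords R I).
Variable mu : probability E R.
Hypothesis mu_iid : iid_normal mu.

(* [50 = 12800 / 256], where the threshold 12800 for [m * F] is such that
   [64 / 12800 + 1 / 256 <= 1 / 100]. *)
Lemma expR_frob2_le (m : nat) (F : R) : 0 <= F <= 1 ->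
  expR (1 / 256 * m%:R * F) <= expR 50 + expR (m%:R / 100) * potential F.
Proof.
move=> /andP[F0 F1]; have m0 : 0 <= m%:R :> R by [].
have [mF|mF] := leP (m%:R * F) 12800.
  rewrite -[leLHS]addr0 lerD ?mulr_ge0 ?expR_ge0 ?potential_ge0//.
  by rewrite ler_expR -mulrA; lra.
rewrite -[leLHS]add0r lerD ?expR_ge0//.
have Fn0 : F != 0 by apply/eqP => F_eq0; move: mF; rewrite F_eq0 mulr0; lra.
have Fp : 0 < F by rewrite lt_def Fn0.
rewrite /potential (negbTE Fn0) -expRD ler_expR.
have h : 64 / F <= m%:R / 200 by rewrite ler_pdivrMr//; lra.
have h2 : m%:R * F <= m%:R by rewrite ler_piMr.
rewrite -mulrA mulNr; move: h h2; move: (64 / F) (m%:R * F) => u v; lra.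
Qed.

(** [expR (1 / 100)] is at most [100 / 99], the inverse of the decay rate of the potential. *)
Lemma expR_geometric (m : nat) : expR (m%:R / 100) * (99 / 100) ^+ m <= 1 :> R.
Proof.
rewrite expRM_natl -exprMn; apply: exprn_ile1.
  by apply: mulr_ge0; [exact: expR_ge0|lra].
have h := expR_ge1Dx (- (1 / 100) : R).
have -> : 100^-1 = 1 / 100 :> R by lra.
rewrite -[expR _]invrK -expRN mulrC ler_pdivrMr ?expR_gt0//.
by move: h; move: (expR _) => y; lra.
Qed.

Variable B : 'M[R]_n.
Hypotheses (pB : sym_psd B) (trB : \tr B <= 1).
Let N (x : E) := residual B (om_of x) (enum 'I_k).

Let mN : measurable_mx N.
Proof. by apply: measurable_residual => //; exact: measurable_om_of. Qed.

(** In the split [expR_frob2_le], the growth [expR (k / 100)] is cancelled by the decay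
    [(99 / 100) ^+ k] of the expected potential. *)
Lemma integral_expR_frob2 :
  (\int[mu]_x (expR (1 / 256 * k%:R * frob2 (N x)))%:E <= (expR 50 + 1)%:E)%E.
Proof.
have mF : measurable_fun setT (fun x => frob2 (N x)) by exact: measurable_frob2.
have mP : measurable_fun setT (fun x => potential (frob2 (N x))).
  exact: measurable_potential.
apply: (@le_trans _ _
  (\int[mu]_x (expR 50 + expR (k%:R / 100) * potential (frob2 (N x)))%:E)%E).
  apply: integral_EFin_le => [|||x].
  - apply: measurableT_comp; [exact: measurable_expR|exact: measurable_funM].
  - by apply: measurable_funD => //; exact: measurable_funM.
  - by move=> x; exact: expR_ge0.
  - by apply: expR_frob2_le; rewrite frob2_ge0 frob2_residual_le1.
have P0 x := potential_ge0 (frob2 (N x)).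
have mZP : measurable_fun setT (fun x => expR (k%:R / 100) * potential (frob2 (N x))).
  exact: measurable_funM.
have ZP0 x : 0 <= expR (k%:R / 100) * potential (frob2 (N x)).
  by rewrite mulr_ge0 ?expR_ge0.
rewrite (ge0_integral_EFinD _ (measurable_cst _) mZP (fun=> expR_ge0 _) ZP0).
rewrite [X in (X + _)%E](_ : _ = (expR 50)%:E); last first.
  apply: etrans (integral_cst mu measurableT (expR 50)%:E) _.
  by rewrite /= probability_setT mule1.
rewrite (EFinD (expR 50)); apply: leeD => //.
rewrite (ge0_integral_EFinZl _ (expR_ge0 _) mP P0).
apply: (@le_trans _ _ ((expR (k%:R / 100))%:E * ((99 / 100) ^+ k)%:E)%E).
  apply: lee_wpmul2l; first by rewrite lee_fin expR_ge0.
  have := integral_potential_residual mu_iid pB trB (enum_uniq 'I_k).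
  by rewrite size_enum_ord.
by rewrite -EFinM lee_fin expR_geometric.
Qed.

(** The trace of the Nystrom part is exact, so only the Hutchinson error of the residual remains. *)
Lemma nystrompp_errorE (Psi Om : 'M[R]_(n, k)) : (0 < k)%N ->
  k%:R * (\tr B - nystrompp B Psi Om) =
  - centered (residual B Om (enum 'I_k)) Psi (enum 'I_k).
Proof.
move=> k0; have kn0 : k%:R != 0 :> R by rewrite pnatr_eq0 -lt0n.
rewrite /nystrompp opprD addrA -linearB /= nystrom_residual//.
rewrite /hutchinson mulrBr mulVKf// /centered sumrB opprB.
congr (_ - _).
  by rewrite big_const_seq count_predT size_enum_ord iter_addr addr0 mulr_natl.
rewrite /mxtrace big_enum; apply: eq_bigr => j _.
rewrite /bform [LHS]mxE [RHS]mxE; apply: eq_bigr => l _.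
rewrite [col _ _ _ _]mxE; congr (_ * _).
by rewrite [LHS]mxE [RHS]mxE; apply: eq_bigr => i _; rewrite !mxE.
Qed.

Lemma integral_expR_error : (0 < k)%N ->
  (\int[mu]_x (expR (k%:R / 32 *
       `| \tr B - nystrompp B (psi_of x) (om_of x) |))%:E <=
   (2 * (expR 50 + 1))%:E)%E.
Proof.
move=> k0.
pose S x := centered (N x) (psi_of x) (enum 'I_k).
have mS : measurable_fun setT S.
  by apply: measurable_centered => //; exact: measurable_psi_of.
have iN x p g : N (upd x (inl p) g) = N x by rewrite /N om_of_upd.
have sN x : (N x)^T = N x by case: (residual_psd (om_of x) (enum 'I_k) pB).
have F1 x : frob2 (N x) <= 1 by exact: frob2_residual_le1.
(* Used for [c = 1/32] and [c = - 1/32]: then [4 * c ^+ 2 = 1/256], the constant of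
   [integral_expR_frob2]. The absolute value is handled by adding the two exponentials. *)
have bound (c : R) : c ^+ 2 = 1 / 1024 ->
    (\int[mu]_x (expR (c * S x))%:E <= (expR 50 + 1)%:E)%E.
  move=> cE; apply: le_trans integral_expR_frob2.
  have c2 : c ^+ 2 <= 1 / 64 by rewrite cE; lra.
  have := integral_expR_centered mu_iid c2 mN sN F1 iN (enum_uniq 'I_k)
    (measurable_cst (0 : R)) (fun _ _ _ => erefl).
  congr (_ <= _)%E; apply: eq_integral => x _; rewrite /= add0r//.
  by rewrite cE size_enum_ord; congr (expR _)%:E; lra.
have errE x : k%:R / 32 * `|\tr B - nystrompp B (psi_of x) (om_of x)| = 1 / 32 * `|S x|.
  rewrite mulrAC -[k%:R in LHS]ger0_norm// -normrM nystrompp_errorE// normrN.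
  by rewrite -/(N x) -/(S x); lra.
have mE c : measurable_fun setT (fun x => expR (c * S x)).
  by apply: measurableT_comp => //; exact: measurable_funM.
under eq_integral => x _ do rewrite errE.
have mabs : measurable_fun setT (fun x => expR (1 / 32 * `|S x|)).
  apply: measurableT_comp => //; apply: measurable_funM => //.
  exact: measurableT_comp.
apply: (@le_trans _ _
  (\int[mu]_x (expR (1 / 32 * S x) + expR (- (1 / 32) * S x))%:E)%E).
  apply: integral_EFin_le => [//||x|x].
  - by apply: measurable_funD; exact: mE.
  - exact: expR_ge0.
  - case: (ger0P (S x)) => _.
      by rewrite lerDl expR_ge0.
    by rewrite mulrN mulNr lerDr expR_ge0.
rewrite (ge0_integral_EFinD _ (mE _) (mE _) (fun=> expR_ge0 _) (fun=> expR_ge0 _)).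
rewrite mulr_natl mulr2n (EFinD (expR 50 + 1)) leeD// bound// ?sqrrN; lra.
Qed.

End ExponentialMoment.

(** * Integration over [t] *)
Section WeightedTail.
Context d1 d2 (T1 : measurableType d1) (T2 : measurableType d2) (R : realType).
Variable m1 : {sigma_finite_measure set T1 -> \bar R}.
Variable mu : probability T2 R.
Variables (p : T1 -> R) (f : T1 * T2 -> R) (s lam eps K : R).
Hypothesis mp : measurable_fun setT p.
Hypothesis mf : measurable_fun setT f.
Hypothesis p0 : forall t, 0 <= p t.
Hypothesis f0 : forall z, 0 <= f z.
Hypothesis pf : forall t x, p t = 0 -> f (t, x) = 0.
Hypothesis intp : (\int[m1]_t (p t)%:E = s%:E)%E.
Hypotheses (lam0 : 0 <= lam) (eps0 : 0 < eps) (K0 : 0 <= K).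
Hypothesis momentK : forall t, p t != 0 ->
  (\int[mu]_x (expR (lam * (f (t, x) / p t)))%:E <= K%:E)%E.

Let excess := [set x | ((eps * s)%:E < \int[m1]_t (f (t, x))%:E)%E].

Let mint : measurable_fun setT (fun x => \int[m1]_t (f (t, x))%:E)%E.
Proof.
apply: (measurable_fun_fubini_tonelli_G (fun z => (f z)%:E)).
  exact/measurable_EFinP.
by move=> z; rewrite lee_fin.
Qed.

Lemma measurable_excess : measurable excess.
Proof.
rewrite -[excess]setTI; exact: (emeasurable_fun_o_infty measurableT mint).
Qed.

Let mf1 x : measurable_fun setT (fun t => f (t, x)).
Proof. exact: (measurableT_comp mf (pair2_measurable x)). Qed.

(** The exponential moment of the relative error [f / p], weighted by [p]; it vanishes where [p]
    does. *)
Let h (z : T1 * T2) : R := p z.1 * expR (lam * (f z / p z.1)).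

Let mh : measurable_fun setT h.
Proof.
have mp1 : measurable_fun setT (fun z : T1 * T2 => p z.1).
  exact: measurableT_comp mp measurable_fst.
apply: measurable_funM => //; apply: measurableT_comp => //.
apply: measurable_funM => //; apply: measurable_funM => //.
exact: measurable_funV.
Qed.

Let h0 z : 0 <= h z.
Proof. by rewrite mulr_ge0// expR_ge0. Qed.

Let mh1 x : measurable_fun setT (fun t => h (t, x)).
Proof. exact: (measurableT_comp mh (pair2_measurable x)). Qed.

Let s0 : 0 <= s.
Proof. by rewrite -lee_fin -intp; apply: integral_ge0 => t _; rewrite lee_fin. Qed.

Let int_h : (\int[mu]_x \int[m1]_t (h (t, x))%:E <= (K * s)%:E)%E.
Proof.
have mhE : measurable_fun setT (fun z => (h z)%:E) by exact/measurable_EFinP.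
have h0E z : (0 <= (h z)%:E)%E by rewrite lee_fin.
rewrite -(fubini_tonelli (m1 := m1) (m2 := mu) (fun z => (h z)%:E) mhE h0E).
rewrite EFinM -intp -(ge0_integral_EFinZl _ K0 mp p0); apply: ge0_le_integral => //.
- by move=> t _; apply: integral_ge0.
- exact: (measurable_fun_fubini_tonelli_F (fun z => (h z)%:E)).
- by apply/measurable_EFinP; exact: measurable_funM.
move=> t _; have [pt0|pt0] := eqVneq (p t) 0.
  rewrite (eq_integral (cst 0%E)) ?integral0 ?lee_fin ?mulr_ge0//.
  by move=> x _; rewrite /h /= pt0 mul0r.
rewrite (ge0_integral_EFinZl (f := fun x => expR (lam * (f (t, x) / p t))) _ (p0 t)).
- by rewrite mulrC EFinM; apply: lee_wpmul2l; [rewrite lee_fin|exact: momentK].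
- apply: measurableT_comp => //; apply: measurable_funM => //.
  apply: measurable_funM => //.
  exact: (measurableT_comp mf (pair1_measurable t)).
- by move=> x; exact: expR_ge0.
Qed.

(* Jensen's inequality for the weights [p / s], in tangent-line form. *)
Let excess_le x : excess x -> ((expR (lam * eps) * s)%:E <= \int[m1]_t (h (t, x))%:E)%E.
Proof.
rewrite /excess /= => /ltW xexcess; set c := expR (lam * eps).
have c0 : 0 <= c by exact: expR_ge0.
have cl0 : 0 <= c * lam by exact: mulr_ge0.
have cle0 : 0 <= c * lam * eps by rewrite mulr_ge0// ltW.
have : (\int[m1]_t (c * p t + c * lam * f (t, x))%:E <=
        \int[m1]_t (h (t, x) + c * lam * eps * p t)%:E)%E.
  apply: integral_EFin_le => [||t|t].
  - by apply: measurable_funD; exact: measurable_funM.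
  - by apply: measurable_funD => //; exact: measurable_funM.
  - by rewrite addr_ge0// mulr_ge0.
  have [pt0|pt0] := eqVneq (p t) 0.
    by rewrite /h /= pf// pt0 !(mulr0, mul0r).
  have pp : 0 < p t by rewrite lt_def pt0 p0.
  rewrite /h /=; set u := f (t, x) / p t.
  have -> : f (t, x) = u * p t by rewrite /u divfK.
  (* The tangent line of the exponential at [lam * eps]. *)
  have : c * (1 + lam * u - lam * eps) <= expR (lam * u).
    rewrite -[in leRHS](subrK (lam * eps) (lam * u)) expRD mulrC -/c.
    by rewrite ler_wpM2r// -addrA expR_ge1Dx.
  move=> /(ler_wpM2l (p0 t)); move: (expR (lam * u)) => w.
  by move: (p t) => q hq; rewrite -subr_ge0; move: hq; rewrite -subr_ge0; congr (0 <= _); ring.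
rewrite ge0_integral_EFinD; first last.
- by move=> t; rewrite mulr_ge0.
- by move=> t; rewrite mulr_ge0.
- exact: measurable_funM.
- exact: measurable_funM.
rewrite ge0_integral_EFinD; first last.
- by move=> t; rewrite mulr_ge0.
- by move=> t; exact: h0.
- exact: measurable_funM.
- exact: mh1.
rewrite (ge0_integral_EFinZl _ c0 mp p0) (ge0_integral_EFinZl _ cle0 mp p0).
rewrite (ge0_integral_EFinZl _ cl0 (mf1 x) (fun t => f0 (t, x))) intp -!EFinM.
move=> H; rewrite -(leeD2rE _ _ (x := (c * lam * eps * s)%:E))//.
apply: le_trans H; apply: leeD => //.
by rewrite -mulrA (EFinM (c * lam)); apply: lee_wpmul2l; rewrite ?lee_fin.
Qed.

(** Markov's inequality for the integral of [h] over [t]: its mean is at most [K * s], and on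
    [excess] it is at least [expR (lam * eps) * s]. *)
Lemma weighted_excess_tail : 0 < s -> (mu excess <= (K * expR (- (lam * eps)))%:E)%E.
Proof.
move=> sp; have cp : 0 < expR (lam * eps) * s by rewrite mulr_gt0 ?expR_gt0.
have mH : measurable_fun setT (fun x => \int[m1]_t (h (t, x))%:E)%E.
  apply: (measurable_fun_fubini_tonelli_G (fun z => (h z)%:E)).
    exact/measurable_EFinP.
  by move=> z; rewrite lee_fin.
have H0 x : (0 <= \int[m1]_t (h (t, x))%:E)%E.
  by apply: integral_ge0 => t _; rewrite lee_fin.
have -> : K * expR (- (lam * eps)) = K * s / (expR (lam * eps) * s).
  rewrite expRN invfM; field.
  by rewrite !gt_eqF ?expR_gt0.
rewrite EFinM lee_pdivlMr// muleC; apply: le_trans int_h.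
apply: (@le_trans _ _ (\int[mu]_(x in excess) \int[m1]_t (h (t, x))%:E)%E).
  rewrite -integral_cst; last exact: measurable_excess.
  apply: ge0_le_integral => //.
  - exact: measurable_excess.
  - by move=> x _; rewrite lee_fin ltW.
  - exact: measurable_funTS.
apply: ge0_subset_integral => //; exact: measurable_excess.
Qed.

(** Here [p] vanishes almost everywhere, hence so does [f (t, x)] for each [x], and the strict
    inequality becomes [0 < 0]. *)
Lemma weighted_excess_null : s = 0 -> excess = set0.
Proof.
move=> s_eq0; apply/seteqP; split => // x; rewrite /excess /= s_eq0 mulr0.
suff -> : (\int[m1]_t (f (t, x))%:E = 0)%E by rewrite ltxx.
have mpE : measurable_fun setT (fun t => (p t)%:E) by exact/measurable_EFinP.
have intabs : (\int[m1]_t `|(p t)%:E| = 0)%E.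
  rewrite -[RHS]/(0%:E) -s_eq0 -intp; apply: eq_integral => t _.
  by rewrite gee0_abs// lee_fin.
have [N [mN N0 subN]] := (ae_eq_integral_abs m1 measurableT mpE).1 intabs.
rewrite (ge0_ae_eq_integral (g := cst 0%E)) ?integral0//.
- exact/measurable_EFinP.
- by move=> t _; rewrite lee_fin.
exists N; split => // t /= nft; apply: subN => /= pt; apply: nft => Dt.
by have [pt0] := pt Dt; rewrite pf.
Qed.

End WeightedTail.

(** * Transfer to the law of the pair of Gaussian matrices *)

Section JointLaw.
Context d (T : measurableType d) (R : realType) (P : probability T R) (n k : nat).
Variables Psi Omega : 'M[{RV P >-> R}]_(n, k).
Hypothesis gauss : independent_gaussian Psi Omega.
Local Notation I := (('I_n * 'I_k) + ('I_n * 'I_k))%type.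

Definition entry (e : I) : {RV P >-> R} :=
  match e with inl ij => Psi ij.1 ij.2 | inr ij => Omega ij.1 ij.2 end.

Definition joint (w : T) : coords R I := fun e => entry e w.

Lemma measurable_joint : measurable_fun setT joint.
Proof. by apply: measurable_to_coords => e; exact: measurable_funP. Qed.

HB.instance Definition _ := isMeasurableFun.Build _ _ _ _ joint measurable_joint.

Lemma iid_normal_joint : iid_normal (distribution P joint).
Proof.
case: gauss => gPsi gOm indep A mA.
rewrite /distribution /pushforward /=.
have := indep [set: I]%SET A mA.
rewrite (_ : [set w | _] = joint @^-1` [set x : coords R I | forall i, A i (x i)]); last first.
  apply/seteqP; split=> w /= h i; first by have := h i (finset.in_setT _); case: (i).
  by move=> _; have := h i; case: (i).
move=> H; apply: (etrans H); apply: eq_big => [i|i _]; first by rewrite finset.in_setT.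
case: i => -[i j]; first exact: (gPsi i j _ (mA (inl (i, j)))).
exact: (gOm i j _ (mA (inr (i, j)))).
Qed.

End JointLaw.

Lemma measurable_restrict_mx (R : realType) n (a b : R) (B : R -> 'M[R]_n) :
  {within `[a, b], continuous B} ->
  measurable_mx (fun t : R => if t \in `[a, b] then B t else 0).
Proof.
move=> cB i j.
have mB : measurable_fun `[a, b]%classic (fun t => B t i j).
  apply: subspace_continuous_measurable_fun; first exact: measurable_itv.
  move=> t; apply: (@continuous_comp (subspace `[a, b]%classic) 'M[R]_n R B
    (fun M : 'M[R]_n => M i j) t); [exact: cB|exact: coord_continuous].
have := (measurable_restrictT _ (measurable_itv `[a, b])).1 mB.
apply: eq_measurable_fun => t _; rewrite patchE mem_setE.
by case: ifP => // _; rewrite mxE.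
Qed.

(** With [m] the maximum in [sample_order], [k / 32 * eps >= (1 + ln K) * m >= ln K + ln delta^-1],
    because [m] dominates both 1 and [ln delta^-1]. *)
Lemma sample_size_bound (R : realType) (K delta eps k : R) :
  1 <= K -> 0 < delta <= 1 -> 0 < eps ->
  32 * (1 + ln K) * sample_order eps delta <= k ->
  K * expR (- (k / 32 * eps)) <= delta.
Proof.
move=> K1 /andP[d0 d1] e0 hk; have K0 : 0 < K by lra.
have lnK0 : 0 <= ln K by exact: ln_ge0.
set m := Num.max 1 (ln delta^-1).
have m1 : 1 <= m by rewrite le_max lexx.
have md : - ln delta <= m by rewrite -lnV ?posrE// le_max lexx orbT.
have h : (1 + ln K) * m <= k / 32 * eps.
  rewrite mulrAC ler_pdivlMr// mulrC mulrA -ler_pdivrMr//.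
  by apply: le_trans hk; rewrite /sample_order -/m mulrA mulrAC.
have h2 : ln K - ln delta <= k / 32 * eps.
  by apply: le_trans h; move: m1 md lnK0; move: m (ln K) (ln delta) => x y z; nra.
rewrite -[X in X * _]lnK ?posrE// -expRD -[leRHS]lnK ?posrE// ler_expR; lra.
Qed.

(** Removes the pseudoinverse from the error, so that measurability in [t] and the matrices, and
    homogeneity in [B], can be read off. *)
Lemma nystrompp_error_normE (R : realType) n k (B : 'M[R]_n) (Psi Om : 'M[R]_(n, k)) :
  (0 < k)%N -> sym_psd B ->
  `|\tr B - nystrompp B Psi Om| =
  k%:R^-1 * `|centered (residual B Om (enum 'I_k)) Psi (enum 'I_k)|.
Proof.
move=> k0 pB; have kn0 : k%:R != 0 :> R by rewrite pnatr_eq0 -lt0n.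
by rewrite -[in RHS]normrN -nystrompp_errorE// normrM ger0_norm// mulKf.
Qed.

Theorem theorem2p5 (R : realType) :
  exists2 C : R, 0 < C &
  forall (n : nat) (a b : R) (B : R -> 'M[R]_n) (delta eps : R) (k : nat)
    (d : measure_display) (T : measurableType d) (P : probability T R)
    (Psi Omega : 'M[{RV P >-> R}]_(n, k)),
  a <= b ->
  (forall t, t \in `[a, b] -> sym_psd (B t)) ->
  {within `[a, b], continuous B} ->
  0 < delta <= 1 ->
  0 < eps < 1 ->
  independent_gaussian Psi Omega ->
  C * sample_order eps delta <= k%:R ->
  ((1 - delta)%:E <=
    P [set w | \int[lebesgue_measure]_(t in `[a, b])
                 `| \tr (B t) - nystrompp (B t) (realization Psi w)
                                  (realization Omega w) |%:E
               <= eps%:E * \int[lebesgue_measure]_(t in `[a, b])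
                             (\tr (B t))%:E])%E.

Proof.
(* The moment bound of [integral_expR_error]. *)
pose K : R := 2 * (expR 50 + 1).
have K1 : 1 <= K by have := expR_gt0 (50 : R); rewrite /K; move: (expR _) => y; lra.
have lnK0 : 0 <= ln K by exact: ln_ge0.
exists (32 * (1 + ln K)); first by move: lnK0; move: (ln K) => y; lra.
move=> n a b B delta eps k d T P Psi Omega ab pB cB d01 /andP[e0 e1] gauss kC.
have K0 : 0 <= K by exact: le_trans K1.
have k0 : (0 < k)%N.
  rewrite -(ltr0n R); apply: lt_le_trans kC; apply: mulr_gt0.
    by move: lnK0; move: (ln K) => y; lra.
  by rewrite mulr_gt0 ?invr_gt0// lt_max ltr01.
pose mu := distribution P (joint Psi Omega).
have mu_iid : iid_normal mu by exact: iid_normal_joint.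
(* Extension by zero, so that the integrals run over the whole line. *)
pose Bt t := if t \in `[a, b] then B t else 0.
pose p t := \tr (Bt t).
pose E := coords R (('I_n * 'I_k) + ('I_n * 'I_k))%type.
pose f (z : measurableTypeR R * E) :=
  `|\tr (Bt z.1) - nystrompp (Bt z.1) (psi_of z.2) (om_of z.2)|.
have pBt t : sym_psd (Bt t).
  rewrite /Bt; case: ifP => [|_]; first exact: pB.
  by split=> [|v]; rewrite ?trmx0// mulmx0 mul0mx mxE.
have mBt : measurable_mx Bt by exact: measurable_restrict_mx.
have fE (z : measurableTypeR R * E) : f z = k%:R^-1 *
    `|centered (residual (Bt z.1) (om_of z.2) (enum 'I_k)) (psi_of z.2) (enum 'I_k)|.
  exact: nystrompp_error_normE.
have mp : measurable_fun setT p by exact: measurable_tr.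
have p0 t : 0 <= p t by exact: psd_tr_ge0.
have f0 (z : measurableTypeR R * E) : 0 <= f z by exact: normr_ge0.
have mf : measurable_fun setT f.
  rewrite (funext fE); apply: measurable_funM => //; apply: measurableT_comp => //.
  apply: measurable_centered => [|i j]; last first.
    exact: (measurableT_comp (measurable_psi_of i j) measurable_snd).
  apply: measurable_residual => i j.
    exact: (measurableT_comp (mBt i j) measurable_fst).
  exact: (measurableT_comp (measurable_om_of i j) measurable_snd).
have pf t x : p t = 0 -> f (t, x) = 0.
  move=> /(psd_tr_eq0 (pBt t)) Bt0; rewrite fE /= Bt0 -(scale0r 0) residualZ.
  by rewrite centeredZ mul0r normr0 mulr0.
have lam0 : 0 <= k%:R / 32 :> R by rewrite divr_ge0.
have momentK t : p t != 0 ->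
    (\int[mu]_x (expR (k%:R / 32 * (f (t, x) / p t)))%:E <= K%:E)%E.
  (* Dividing [Bt t] by its trace gives a matrix of trace 1 whose error is the relative error
     [f (t, x) / p t]. *)
  move=> pt0; have ip0 : 0 <= (p t)^-1 by rewrite invr_ge0.
  have pA := psdZ ip0 (pBt t).
  have trA : \tr ((p t)^-1 *: Bt t) <= 1 by rewrite mxtraceZ mulVf.
  have := integral_expR_error mu_iid pA trA k0.
  congr (_ <= _)%E; apply: eq_integral => x _; congr (expR (_ * _))%:E.
  rewrite nystrompp_error_normE// residualZ centeredZ normrM ger0_norm// fE /=.
  by rewrite mulrCA mulrC.
have restrictE (g : R -> R) (g' : R -> R) :
    (forall t, t \in `[a, b] -> g t = g' t) -> (forall t, t \notin `[a, b] -> g' t = 0) ->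
    (\int[lebesgue_measure]_(t in `[a, b]) (g t)%:E =
     \int[lebesgue_measure]_t (g' t)%:E)%E.
  move=> gg' g'0; rewrite integral_mkcond; apply: eq_integral => t _.
  rewrite patchE mem_setE; case: ifPn => tab; first by rewrite gg'.
  by rewrite g'0.
have pout t : t \notin `[a, b] -> p t = 0.
  by rewrite /p /Bt => /negbTE ->; rewrite mxtrace0.
have intp : (\int[lebesgue_measure]_(t in `[a, b]) (\tr (B t))%:E =
    \int[lebesgue_measure]_t (p t)%:E)%E.
  by apply: restrictE => // t tab; rewrite /p /Bt tab.
have intf w : (\int[lebesgue_measure]_(t in `[a, b])
      `|\tr (B t) - nystrompp (B t) (realization Psi w) (realization Omega w)|%:E =
    \int[lebesgue_measure]_t (f (t, joint Psi Omega w))%:E)%E.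
  apply: restrictE => t tab; last by rewrite pf// pout.
  have psiE : psi_of (joint Psi Omega w) = realization Psi w.
    by apply/matrixP => i j; rewrite !mxE.
  have omE : om_of (joint Psi Omega w) = realization Omega w.
    by apply/matrixP => i j; rewrite !mxE.
  by rewrite /f /= psiE omE /Bt tab.
rewrite intp.
under eq_set do rewrite intf.
case intpE : (\int[lebesgue_measure]_t (p t)%:E)%E => [s| |]; last 2 first.
- rewrite (_ : [set w | _] = setT); last first.
    by apply/seteqP; split => // w _ /=; rewrite gt0_muley ?lte_fin// leey.
  by rewrite probability_setT lee_fin; case/andP: d01 => d0 _; lra.
- have : (0 <= \int[lebesgue_measure]_t (p t)%:E)%E.
    by apply: integral_ge0 => t _; rewrite lee_fin.
  by rewrite intpE.
pose excess := [set x : E |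
  ((eps * s)%:E < \int[lebesgue_measure]_t (f (t, x))%:E)%E].
have mexcess : measurable excess by exact: (measurable_excess lebesgue_measure s eps mf f0).
have -> : [set w | (\int[lebesgue_measure]_t (f (t, joint Psi Omega w))%:E <=
    eps%:E * s%:E)%E] = joint Psi Omega @^-1` (~` excess).
  apply/seteqP; split => w /=; rewrite /excess /= -EFinM.
    by move=> h; apply/negP; rewrite -leNgt.
  by move=> /negP; rewrite -leNgt.
rewrite preimage_setC probability_setC; last first.
  rewrite -[X in measurable X]setTI.
  exact: (@measurable_joint _ _ _ _ _ _ Psi Omega measurableT _ mexcess).
suff : (mu excess <= delta%:E)%E by move=> h; rewrite EFinB; apply: leeB.
(* The Markov bound divides by [s], so total weight zero is treated apart. *)
have [s_eq0|s_neq0] := eqVneq s 0.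
  rewrite /excess (@weighted_excess_null _ _ _ _ R lebesgue_measure p f s eps
    mp mf p0 f0 pf intpE s_eq0).
  have -> : mu set0 = 0%E by exact: measure0.
  rewrite lee_fin.
  by case/andP: d01 => /ltW.
have s0 : 0 < s.
  rewrite lt_def s_neq0 -lee_fin -intpE.
  by apply: integral_ge0 => t _; rewrite lee_fin.
apply: le_trans (@weighted_excess_tail _ _ _ _ R lebesgue_measure mu
  p f s _ eps K mp mf p0 f0 pf intpE lam0 e0 K0 momentK s0) _.
by rewrite lee_fin; exact: sample_size_bound kC.
Qed.
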